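(* Let $X: M\to\mathbb{R}^{m+n}$ be an oriented $n$-dimensional immersed submanifold of $\mathbb{R}^{m+n}$, with the induced metric, let $H$ be its mean curvature vector, and let $\rho:=e^{-|X|^2/4}$. Then the Gauss map $\gamma: M\to \mathbf{G}_{n,m}$ is a $\rho$-weighted harmonic map if and only if $H+\frac{1}{2}X^N$ is a parallel section of the normal bundle $NM$ (with respect to the normal connection).
   Context: $M$ carries the metric $g$ induced by the isometric immersion $X$. Let $\nabla$ and $\overline\nabla$ be the Levi-Civita connections of $M$ and $\mathbb{R}^{m+n}$. $(\cdot)^N$ and $(\cdot)^T$ denote orthogonal projection onto the normal bundle $NM$ and the tangent bundle $TM$; $X$ also denotes the position vector. The second fundamental form is $B_{VW}=(\overline\nabla_V W)^N$, and the mean curvature vector $H$ is the trace of $B$ with respect to $g$ (no factor $1/n$). The normal connection is $\nabla_V\nu=(\overline\nabla_V\nu)^N$. $\mathbf{G}_{n,m}$ is the Grassmannian of oriented $n$-dimensional linear subspaces of $\mathbb{R}^{m+n}$, with its canonical Riemannian metric (that induced by the Plücker embedding $P\mapsto e_1\wedge\cdots\wedge e_n$, where $e_1,\dots,e_n$ is an oriented orthonormal basis of $P$). The Gauss map $\gamma$ sends $p\in M$ to the oriented subspace obtained by parallel translating $T_pM$ to the origin. Weighted harmonic maps: let $f:(M,g)\to(N,h)$ be a smooth map between Riemannian manifolds and $w$ a smooth positive function on $M$. The $w$-weighted tension field is $\tau_w(f)=w^{-1}\sum_i\big(\nabla_{e_i}(w\,df)\big)(e_i)$, where $\{e_i\}$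 is a local orthonormal frame on $M$ and $\nabla$ is the natural connection on $T^*M\otimes f^{-1}TN$. The map $f$ is called $w$-weighted harmonic if $\tau_w(f)=0$ (equivalently, $f$ is a critical point, under compactly supported variations, of the weighted energy $\frac12\int_\Omega\sum_i\langle f_*e_i,f_*e_i\rangle\, w$ for relatively compact domains $\Omega\subset M$). *)

(* Defs.v *)
From HB Require Import structures.
From mathcomp Require Import all_boot all_order all_algebra.
From mathcomp Require Import all_classical all_reals all_analysis.

Set Implicit Arguments.
Unset Strict Implicit.
Unset Printing Implicit Defensive.

Import Order.TTheory GRing.Theory Num.Theory.
Import numFieldNormedType.Exports.
Local Open Scope classical_set_scope.
Local Open Scope ring_scope.

(* Conventions.  Tangent and ambient vectors are row vectors.  The inner
   product of R^N is [u *m v^T] (the norm [`|u|] of the library is the sup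
   norm, equivalent for topology and differentiability but not used for
   lengths).  [jacobian f x] is the library's Jacobian,
   [v *m jacobian f x = 'D_v f x], so its i-th row is the i-th partial
   derivative of f. *)

Section Calculus.
Variable R : realType.

Definition pderiv (V : normedModType R) n (i : 'I_n) (f : 'rV[R]_n -> V)
  (x : 'rV[R]_n) : V := 'D_(delta_mx 0 i) f x.

Fixpoint Ck_on (V W : normedModType R) (k : nat) (U : set V) (f : V -> W) :
  Prop :=
  match k with
  | 0 => forall x, U x -> {for x, continuous f}
  | k'.+1 => (forall x, U x -> differentiable f x) /\
             (forall v, Ck_on k' U (fun x => 'D_v f x))
  end.

Definition smooth_on (V W : normedModType R) (U : set V) (f : V -> W) :=
  forall k, Ck_on k U f.

End Calculus.

Section Charts.
Variable R : realType.

(* The bare data of an atlas.  Only the values of [chart_map i] on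
   [chart_dom i], and of [chart_inv i] on [chart_range i], are meaningful. *)
Record atlas (d : nat) (T : Type) := Atlas {
  chart_idx : Type;
  chart_dom : chart_idx -> set T;
  chart_map : chart_idx -> T -> 'rV[R]_d;
  chart_inv : chart_idx -> 'rV[R]_d -> T }.

Definition chart_range d T (A : atlas d T) (i : chart_idx A) : set 'rV[R]_d :=
  chart_map i @` chart_dom i.

(* The orientation is the one for which all charts are positive. *)
Record is_oriented_manifold (n : nat) (M : topologicalType) (A : atlas n M) :
  Prop := IsOrientedManifold {
  manifold_hausdorff : hausdorff_space M;
  manifold_countable : @second_countable M;
  chart_cover : forall p, exists i, @chart_dom n M A i p;
  chart_dom_open : forall i, open (@chart_dom n M A i);
  chart_range_open : forall i, open (@chart_range n M A i);
  chart_invK : forall i p, @chart_dom n M A i p ->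
    chart_inv i (chart_map i p) = p;
  chart_map_continuous : forall i p, @chart_dom n M A i p ->
    {for p, continuous (chart_map i)};
  chart_inv_continuous : forall i x, @chart_range n M A i x ->
    {for x, continuous (chart_inv i)};
  transition_smooth : forall i j,
    smooth_on (chart_map i @` (@chart_dom n M A i `&` @chart_dom n M A j))
      (chart_map j \o chart_inv i);
  transition_oriented : forall i j p,
    @chart_dom n M A i p -> @chart_dom n M A j p ->
    0 < \det (jacobian (chart_map j \o chart_inv i) (chart_map i p)) }.

Definition is_smooth_immersion n N (T : Type) (A : atlas n T)
    (X : T -> 'rV[R]_N) : Prop :=
  forall i : chart_idx A,
    smooth_on (chart_range i) (X \o chart_inv i) /\
    forall x, chart_range i x -> row_free (jacobian (X \o chart_inv i) x).

(* A Riemannian metric, given by its Gram matrix in each chart. *)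
Definition chart_metric n T (A : atlas n T) :=
  forall i : chart_idx A, 'rV[R]_n -> 'M[R]_n.

Definition induced_metric n N (T : Type) (A : atlas n T)
    (X : T -> 'rV[R]_N) : chart_metric A :=
  fun i x => let J := jacobian (X \o chart_inv i) x in J *m J^T.

End Charts.

Arguments induced_metric {R n N T} A X.

Section Riemannian.
Variable R : realType.

(* The trace with respect to the inner product of Gram matrix G of the
   bilinear map with coefficients T; see [metric_trace_orthonormal]. *)
Definition metric_trace n (V : lmodType R) (G : 'M[R]_n)
    (T : 'I_n -> 'I_n -> V) : V :=
  \sum_i \sum_j invmx G i j *: T i j.

(* The coefficient of the k-th coordinate field in the Levi-Civita derivative
   of the j-th coordinate field along the i-th one. *)
Definition christoffel n (g : 'rV[R]_n -> 'M[R]_n) (x : 'rV[R]_n)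
    (k i j : 'I_n) : R :=
  2^-1 * \sum_l invmx (g x) k l *
    (pderiv i (fun y => g y j l) x + pderiv j (fun y => g y i l) x
     - pderiv l (fun y => g y i j) x).

(* The natural connection on T^*M (x) u^{-1}TN in coordinates, where u is a
   map from (an open set of) R^n with metric g to R^d with metric h, and
   where the row j of [alpha y] is the value at the j-th coordinate field of
   the u^{-1}TN-valued 1-form alpha.  The result is
   (nabla_{d_i} alpha)(d_j)
     = nabla_{d_i} (alpha (d_j)) - alpha (nabla_{d_i} d_j). *)
Definition natural_connection n d (g : 'rV[R]_n -> 'M[R]_n)
    (h : 'rV[R]_d -> 'M[R]_d) (u : 'rV[R]_n -> 'rV[R]_d)
    (alpha : 'rV[R]_n -> 'M[R]_(n, d)) (x : 'rV[R]_n) (i j : 'I_n) :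
    'rV[R]_d :=
  \row_c (pderiv i (fun y => alpha y j c) x
          + \sum_a \sum_b
              christoffel h (u x) c a b * jacobian u x i a * alpha x j b
          - \sum_k christoffel g x k i j * alpha x k c).

Definition weighted_tension n d (g : 'rV[R]_n -> 'M[R]_n)
    (h : 'rV[R]_d -> 'M[R]_d) (w : 'rV[R]_n -> R)
    (u : 'rV[R]_n -> 'rV[R]_d) (x : 'rV[R]_n) : 'rV[R]_d :=
  (w x)^-1 *: metric_trace (g x)
    (natural_connection g h u (fun y => w y *: jacobian u y) x).

Definition weighted_harmonic n d (S T : Type) (A : atlas R n S)
    (g : chart_metric A) (B : atlas R d T) (h : chart_metric B)
    (w : S -> R) (f : S -> T) : Prop :=
  forall (i : chart_idx A) (j : chart_idx B) (p : S),
    chart_dom i p -> chart_dom j (f p) ->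
    weighted_tension (g i) (h j) (w \o chart_inv i)
      (chart_map j \o f \o chart_inv i) (chart_map i p) = 0.

Lemma metric_trace_orthonormal n (V : lmodType R) (G : 'M[R]_n)
    (T : 'I_n -> 'I_n -> V) (e : 'M[R]_n) :
  e *m G *m e^T = 1%:M ->
  metric_trace G T = \sum_k \sum_i \sum_j (e k i * e k j) *: T i j.
Proof.
move=> eGe.
have GeeT : G *m (e^T *m e) = 1%:M.
  by rewrite mulmxA; apply: mulmx1C; rewrite mulmxA.
have [Gu _] := mulmx1_unit GeeT.
have Ge : invmx G = e^T *m e by rewrite -[LHS]mulmx1 -GeeT mulKmx.
rewrite /metric_trace Ge [RHS]exchange_big /=; apply: eq_bigr => i _.
rewrite [RHS]exchange_big /=; apply: eq_bigr => j _.
rewrite mxE -scaler_suml; congr (_ *: _).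
by apply: eq_bigr => k _; rewrite mxE.
Qed.

End Riemannian.

Section Grassmannian.
Variable R : realType.
Variables n m : nat.

(* An oriented n-dimensional subspace of R^(m+n) is represented by the set of
   its positively oriented bases (a basis being the rows of a matrix). *)
Definition oriented_span (E : 'M[R]_(n, m + n)) : set 'M[R]_(n, m + n) :=
  [set C *m E | C in [set C : 'M[R]_n | 0 < \det C]].

(* Strictly increasing multi-indices; the n-vectors e_(I 0) /\ ... /\ e_(I n-1)
   form the standard orthonormal basis of the n-th exterior power. *)
Definition multi_index :=
  {I : {ffun 'I_n -> 'I_(m + n)} |
    [forall i : 'I_n, forall j : 'I_n, (i < j)%N ==> (I i < I j)%N]}.

(* The coordinates of the exterior product of the rows of E. *)
Definition wedge (E : 'M[R]_(n, m + n)) : 'rV[R]_#|{: multi_index}| :=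
  \row_k \det (colsub (val (enum_val k : multi_index)) E).

(* e_1 /\ ... /\ e_n for an orthonormal positively oriented basis of P (any
   one of them: they differ by a rotation, which does not change [wedge]). *)
Definition plucker (P : set 'M[R]_(n, m + n)) : 'rV[R]_#|{: multi_index}| :=
  xget 0 [set wedge E | E in [set E | P E /\ E *m E^T = 1%:M]].

(* The charts of the Grassmannian are indexed by the orthonormal bases
   (nu_1, ..., nu_m, e_1, ..., e_n) of R^(m+n); the subspace of coordinates
   z is spanned by the e_i + sum_a z_ia nu_a, in this order. *)
Definition grass_inv (Q : {Q : 'M[R]_(m + n) | Q *m Q^T = 1%:M})
    (z : 'rV[R]_(n * m)) : set 'M[R]_(n, m + n) :=
  oriented_span (dsubmx (sval Q) + vec_mx z *m usubmx (sval Q)).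

(* Only [chart_inv] is explicit: [chart_map] is its inverse. *)
Definition grassmannian : atlas R (n * m) (set 'M[R]_(n, m + n)) :=
  @Atlas R _ _ {Q : 'M[R]_(m + n) | Q *m Q^T = 1%:M}
    (fun Q => range (grass_inv Q))
    (fun Q P => xget 0 [set z | grass_inv Q z = P])
    grass_inv.

Definition grass_metric : chart_metric grassmannian :=
  induced_metric grassmannian plucker.

End Grassmannian.

Arguments grass_metric : clear implicits.

Section Submanifold.
Variable R : realType.

(* Orthogonal projection to the orthogonal complement of the row space of J,
   for J with linearly independent rows. *)
Definition normal_proj n N (J : 'M[R]_(n, N)) (v : 'rV[R]_N) : 'rV[R]_N :=
  v - v *m J^T *m invmx (J *m J^T) *m J.

(* F is a local parametrization of the submanifold, and B(d_i, d_j) is the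
   normal part of the flat derivative of d_j F along d_i. *)
Definition second_fundamental_form n N (F : 'rV[R]_n -> 'rV[R]_N)
    (x : 'rV[R]_n) (i j : 'I_n) : 'rV[R]_N :=
  normal_proj (jacobian F x) (pderiv i (pderiv j F) x).

Definition mean_curvature n N (F : 'rV[R]_n -> 'rV[R]_N) (x : 'rV[R]_n) :
    'rV[R]_N :=
  metric_trace (jacobian F x *m (jacobian F x)^T)
    (second_fundamental_form F x).

(* H + X^N / 2, in the local parametrization F. *)
Definition shrinker_section n N (F : 'rV[R]_n -> 'rV[R]_N) (x : 'rV[R]_n) :
    'rV[R]_N :=
  mean_curvature F x + 2^-1 *: normal_proj (jacobian F x) (F x).

(* nu i is the expression in the chart i of a section of the normal bundle. *)
Definition parallel_normal n N (T : Type) (A : atlas R n T)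
    (X : T -> 'rV[R]_N) (nu : chart_idx A -> 'rV[R]_n -> 'rV[R]_N) : Prop :=
  forall (i : chart_idx A) (x : 'rV[R]_n), chart_range i x ->
  forall v : 'rV[R]_n,
    normal_proj (jacobian (X \o chart_inv i) x) ('D_v (nu i) x) = 0.

(* The set of positively oriented bases of dX(T_pM); it does not depend on the
   chart, see [gauss_mapE]. *)
Definition gauss_map n m (T : Type) (A : atlas R n T)
    (X : T -> 'rV[R]_(m + n)) (p : T) : set 'M[R]_(n, m + n) :=
  [set E | exists2 i : chart_idx A, chart_dom i p &
    oriented_span (jacobian (X \o chart_inv i) (chart_map i p)) E].

Definition gauss_weight N (T : Type) (X : T -> 'rV[R]_N) (p : T) : R :=
  expR (- (X p *m (X p)^T) 0 0 / 4).

Lemma normal_projE n N (J : 'M[R]_(n, N)) (v : 'rV[R]_N) :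
  row_free J ->
  normal_proj J v *m J^T = 0 /\ (v - normal_proj J v <= J)%MS.
Proof.
move=> Jf; have JJu : J *m J^T \in unitmx.
  rewrite -row_free_unit -kermx_eq0; apply/rowV0P => a /sub_kermxP aJJ.
  have aJ0 : a *m J = 0.
    have : (a *m J) *m (a *m J)^T = 0.
      by rewrite trmx_mul mulmxA -(mulmxA a) aJJ mul0mx.
    move=> /matrixP/(_ 0 0); rewrite !mxE => s0.
    apply/rowP => k; rewrite [RHS]mxE; apply/eqP; rewrite -sqrf_eq0.
    have /eqP : \sum_j (a *m J) 0 j ^+ 2 = 0.
      rewrite -[RHS]s0; apply: eq_bigr => j _.
      by rewrite expr2 [X in _ = _ * X]mxE.
    rewrite psumr_eq0 => [/allP/(_ k)|j _]; last exact: sqr_ge0.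
    by apply; rewrite mem_index_enum.
  by apply/eqP; rewrite -(mulmx_free_eq0 _ Jf) aJ0.
split; last by rewrite /normal_proj opprD addrA subrr add0r opprK submxMl.
by rewrite /normal_proj mulmxBl -!mulmxA mulVmx // mulmx1 subrr.
Qed.

Lemma gauss_mapE n m (M : topologicalType) (A : atlas R n M)
    (X : M -> 'rV[R]_(m + n)) (i : chart_idx A) (p : M) :
  is_oriented_manifold A -> is_smooth_immersion A X -> chart_dom i p ->
  gauss_map A X p =
  oriented_span (jacobian (X \o chart_inv i) (chart_map i p)).
Proof.
move=> mA iX ip; apply/seteqP; split=> [E [j jp]|E Ei]; last by exists i.
set y := chart_map j p; set x := chart_map i p.
have yE : chart_inv j y = p by rewrite /y (chart_invK mA).
have jy : chart_range j y by exists p.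
have ix : chart_range i x by exists p.
set t := chart_map i \o chart_inv j.
have tyE : t y = x by rewrite /t /= yE.
have dt : differentiable t y.
  have [+ _] := transition_smooth mA j i 1%N; apply.
  by exists p.
have dX : differentiable (X \o chart_inv i) (t y).
  have [/(_ 1%N) [+ _] _] := iX i; apply.
  by rewrite tyE.
have near_eq : \forall z \near y,
    (X \o chart_inv j) z = (X \o chart_inv i \o t) z.
  have /(_ _ (open_nbhs_nbhs (conj (chart_dom_open mA i) _))) :=
    chart_inv_continuous mA jy; rewrite yE => /(_ ip).
  rewrite /= => Hi; near=> z => /=; rewrite /t /= (chart_invK mA) //.
  by near: z; exact: Hi.
have Jchain : jacobian (X \o chart_inv j) y =
    jacobian t y *m jacobian (X \o chart_inv i) x.
  have dc : differentiable (X \o chart_inv i \o t) y.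
    exact: differentiable_comp.
  have dj : differentiable (X \o chart_inv j) y.
    by have [/(_ 1%N) [+ _] _] := iX j; apply.
  apply/row_matrixP => k; rewrite !rowE mulmxA.
  rewrite -!deriveEjacobian //; last by rewrite -tyE.
  rewrite (near_eq_derive _ near_eq) deriveE // diff_comp //= -deriveE //.
  by rewrite tyE -deriveE.
have dpos : 0 < \det (jacobian t y) := transition_oriented mA jp ip.
rewrite Jchain => -[C /= C0 <-]; exists (C *m jacobian t y).
  by rewrite /= det_mulmx mulr_gt0.
by rewrite mulmxA.
Unshelve. all: by end_near. Qed.

End Submanifold.

Arguments parallel_normal {R n N T} A X nu.

(* Main.v *)
(* Fix a local parametrization F of M with Jacobian matrix J, and a chart of the
   Grassmannian given by an orthonormal frame (nu, e) of the ambient space.  In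
   this chart the Gauss map is Z = a^-1 b, where a = J e^T and b = J nu^T, and
   the columns of V = nu^T - e^T Z span the normal space.  Then
   d_i Z = a^-1 (d_i J) V is the second fundamental form read in the normal
   frame V.  By Cauchy-Binet, the Pluecker embedding induces on the chart the
   metric <A, B> = tr ((1 + Z Z^T)^-1 A (1 + Z^T Z)^-1 B^T), whose Christoffel
   term is - (A Z^T (1 + Z Z^T)^-1 B + B Z^T (1 + Z Z^T)^-1 A).  With it, the
   second covariant derivative of Z becomes the covariant derivative of the
   second fundamental form.  Its trace is, by the Codazzi symmetry, the normal
   derivative of H, and the drift term of the weight rho is the normal
   derivative of X^N / 2.  Hence the k-th row of a times the weighted tension is
   d_k (H + X^N / 2) V, at every point and in every chart, and a is invertible. *)
Require Import Defs.
From HB Require Import structures.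
From mathcomp Require Import all_boot all_order all_algebra all_fingroup.
From mathcomp Require Import all_classical all_reals all_analysis.
From mathcomp Require Import ring lra.

Set Implicit Arguments.
Unset Strict Implicit.
Unset Printing Implicit Defensive.

Import Order.TTheory GRing.Theory Num.Theory.
Import numFieldNormedType.Exports.
Local Open Scope classical_set_scope.
Local Open Scope ring_scope.

(** * Orthonormalization *)

(** The weighted tension involves the Christoffel symbols of a metric induced by [plucker], which
    are unwieldy to expand. The metric is therefore read off the polarized product of two Pluecker
    vectors, a determinant up to scalar factors, and the symbols are identified after lowering an
    index, so that the inverse of the Grassmannian metric is never computed. What absorbs the terms
    in Z is the identity e^T + V Z^T (1 + Z Z^T)^-1 = J^T (J J^T)^-1 a: it merges the Christoffel
    term with the derivatives of a^-1 and V into the tangential projection. Both sides are compared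
    after right multiplication by V. This kills tangent vectors, so the tangential coefficients
    produced by differentiating a normal projection may stay unknown, and it loses nothing on normal
    parts. The comparison is pointwise and valid in every chart that sees the tangent space; a frame
    adapted to the tangent space only ensures that such a chart exists. Inverses, Jacobians and
    chart expressions are controlled only on open sets, hence the many statements about points near
    [x]. *)

Section Gram.
Variable R : realType.

Lemma mulmx_tr_eq0 n (v : 'rV[R]_n) : v *m v^T = 0 -> v = 0.
Proof.
move=> /matrixP/(_ 0 0); rewrite !mxE => s0.
apply/rowP => k; rewrite [RHS]mxE; apply/eqP; rewrite -sqrf_eq0.
have /eqP : \sum_j v 0 j ^+ 2 = 0.
  by rewrite -[RHS]s0; apply: eq_bigr => j _; rewrite expr2 [X in _ = _ * X]mxE.
rewrite psumr_eq0 => [/allP/(_ k)|j _]; last exact: sqr_ge0.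
by apply; rewrite mem_index_enum.
Qed.

Lemma mulmx_tr_ge0 n (v : 'rV[R]_n) : 0 <= (v *m v^T) 0 0.
Proof. by rewrite mxE sumr_ge0 // => i _; rewrite mxE -expr2 sqr_ge0. Qed.

Lemma gram_unit n N (J : 'M[R]_(n, N)) : row_free J -> J *m J^T \in unitmx.
Proof.
move=> Jf; rewrite -row_free_unit -kermx_eq0; apply/rowV0P => a /sub_kermxP aJJ.
apply/eqP; rewrite -(mulmx_free_eq0 _ Jf); apply/eqP/mulmx_tr_eq0.
by rewrite trmx_mul mulmxA -(mulmxA a) aJJ mul0mx.
Qed.

(** Gram-Schmidt as an induction: a lower unitriangular [L] clears the first row and column of [G]
    off the diagonal and leaves the Schur complement [G']. [C] is built from triangular factors with
    positive diagonal, so orthonormalizing preserves the orientation. *)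
Lemma diagonalize_gram n (G : 'M[R]_n) : G^T = G ->
    (forall v : 'rV[R]_n, v != 0 -> 0 < (v *m G *m v^T) 0 0) ->
  exists2 C : 'M[R]_n, 0 < \det C & C *m G *m C^T = 1%:M.
Proof.
elim: n G => [|n IH] G Gs Gp.
  by exists 1%:M; rewrite ?det1 ?ltr01 //; apply/matrixP => -[].
rewrite -[n.+1]/(1 + n)%N in G Gs Gp *.
set g := ulsubmx G; set b := ursubmx G; set c := drsubmx G.
have Gb : G = block_mx g b b^T c.
  by rewrite /b trmx_ursub Gs submxK.
have g0 : 0 < g 0 0.
  have := Gp (row_mx 1%:M 0); rewrite Gb mul_row_block tr_row_mx mul_row_col.
  rewrite !mul1mx !mul0mx !addr0 !trmx1 !trmx0 !mulmx1 !mulmx0 !addr0; apply.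
  apply/negP => /eqP/(congr1 lsubmx); rewrite row_mxKl => /matrixP/(_ 0 0).
  by rewrite !mxE !eqxx => /eqP; rewrite oner_eq0.
have cs : c^T = c by rewrite /c trmx_drsub Gs.
have gE : g = (g 0 0)%:M by rewrite -mx11_scalar.
pose l := - (g 0 0)^-1 *: b^T.
have lgb : l *m g + b^T = 0.
  rewrite gE mul_mx_scalar /l scalerA mulrN divff ?gt_eqF // scaleN1r addrC.
  by rewrite subrr.
have glb : g *m l^T + b = 0.
  by have /(congr1 trmx) := lgb; rewrite linearD /= trmx_mul trmxK trmx0 gE tr_scalar_mx.
pose G' := c + l *m b.
have [C' C'0 C'G] : exists2 C : 'M[R]_n, 0 < \det C & C *m G' *m C^T = 1%:M.
  apply: IH => [|v v0].
    rewrite /G' linearD /= cs trmx_mul /l linearZ /= trmxK.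
    by rewrite -scalemxAr -scalemxAl.
  (* The quadratic form of [G'] at [v] is that of [G] at the vector [(v l, v)]. *)
  have := Gp (row_mx (v *m l) v); rewrite Gb mul_row_block tr_row_mx mul_row_col.
  rewrite -!mulmxA -!mulmxDr lgb !mulmx0 mul0mx add0r mulmxA /G' addrC; apply.
  apply/negP => /eqP/(congr1 rsubmx); rewrite row_mxKr => v0'.
  by move/eqP: v0; apply; rewrite v0'; apply/matrixP => i j; rewrite !mxE.
pose L : 'M[R]_(1 + n) := block_mx 1%:M 0 l 1%:M.
pose D : 'M[R]_(1 + n) := block_mx (Num.sqrt (g 0 0))^-1%:M 0 0 C'.
exists (D *m L).
  rewrite det_mulmx det_ublock det_lblock !det1 !mulr1 det_scalar1.
  by rewrite mulr_gt0 // invr_gt0 sqrtr_gt0.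
have LGL : L *m G *m L^T = block_mx g 0 0 G'.
  rewrite Gb /L tr_block_mx !trmx1 trmx0 !mulmx_block.
  rewrite !mul1mx !mul0mx !addr0 !mulmx0 !mulmx1 !addr0 lgb glb mul0mx add0r.
  by rewrite addrC.
have -> : D *m L *m G *m (D *m L)^T = D *m (L *m G *m L^T) *m D^T.
  by rewrite trmx_mul !mulmxA.
rewrite LGL /D tr_block_mx !trmx0 tr_scalar_mx !mulmx_block.
rewrite !(mul0mx, mulmx0, addr0, add0r) C'G.
rewrite mul_mx_scalar mul_scalar_mx scalerA [X in _ *: X]gE scale_scalar_mx -invfM -expr2.
by rewrite sqr_sqrtr ?ltW // mulVf ?gt_eqF // -scalar_mx_block.
Qed.

Lemma row_free_orthonormalize n N (E : 'M[R]_(n, N)) : row_free E ->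
  exists2 C : 'M[R]_n, 0 < \det C & (C *m E) *m (C *m E)^T = 1%:M.
Proof.
move=> Ef; have [||C C0 CE] := @diagonalize_gram _ (E *m E^T).
- by rewrite trmx_mul trmxK.
- move=> v v0; rewrite mulmxA -mulmxA -trmx_mul lt_neqAle mulmx_tr_ge0 andbT.
  apply: contra v0 => /eqP vE.
  rewrite -(mulmx_free_eq0 _ Ef); apply/eqP/mulmx_tr_eq0.
  by apply/matrixP => i j; rewrite !ord1 -vE mxE.
- by exists C => //; rewrite trmx_mul !mulmxA -CE !mulmxA.
Qed.

Lemma orthonormal_row_free n N (E : 'M[R]_(n, N)) : E *m E^T = 1%:M -> row_free E.
Proof. by move=> EE; apply/row_freeP; exists E^T. Qed.

Lemma row_free_basis n N (A : 'M[R]_(n, N)) r : \rank A = r ->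
  exists2 B : 'M[R]_(r, N), row_free B & (B <= A)%MS.
Proof.
by move=> <-; exists (row_base A); rewrite ?row_base_free ?eq_row_base.
Qed.

Lemma orthonormal_extend n m (E : 'M[R]_(n, m + n)) : E *m E^T = 1%:M ->
  exists nu : 'M[R]_(m, m + n), col_mx nu E *m (col_mx nu E)^T = 1%:M.
Proof.
move=> EE; have rE : \rank (kermx E^T) = m.
  rewrite mxrank_ker mxrank_tr; move/orthonormal_row_free/eqP: EE => ->.
  by rewrite addnK.
have [B Bf /sub_kermxP BE] := row_free_basis rE.
have [C _ CB] := row_free_orthonormalize Bf.
exists (C *m B); rewrite tr_col_mx mul_col_row CB EE -mulmxA BE mulmx0.
have -> : E *m (C *m B)^T = 0.
  by rewrite trmx_mul mulmxA -[E]trmxK -trmx_mul BE trmx0 mul0mx.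
by rewrite -scalar_mx_block.
Qed.

End Gram.

(** * The Cauchy-Binet formula *)

Section CauchyBinet.
Variables n m : nat.

Definition index_of_perm (p : multi_index n m * 'S_n) :
  {ffun 'I_n -> 'I_(m + n)} := [ffun i => val p.1 (p.2 i)].

Lemma multi_index_sorted (I : multi_index n m) :
  sorted ltn [seq val (val I i) | i <- enum 'I_n].
Proof.
rewrite sorted_map.
have /forallP mono := valP I.
have : sorted (relpre val ltn) (enum 'I_n).
  by rewrite -sorted_map val_enum_ord iota_ltn_sorted.
by apply: sub_sorted => i j /= ij; have /forallP/(_ j)/implyP := mono i; apply.
Qed.

Lemma multi_index_inj (I : multi_index n m) : injective (val I).
Proof.
have /forallP mono := valP I.
have lt (i j : 'I_n) : (i < j)%N -> val I i != val I j.
  move=> ij; have /forallP/(_ j)/implyP/(_ ij) := mono i.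
  by apply: contraTneq => ->; rewrite ltnn.
move=> i j Iij; apply/ord_inj; case: (ltngtP i j) => // /lt.
  by rewrite Iij eqxx.
by rewrite Iij eqxx.
Qed.

(** An increasing list is determined by its set of values, which a permutation of the places does
    not change; once the multi-indices agree, their injectivity recovers the permutation. *)
Lemma index_of_perm_inj : injective index_of_perm.
Proof.
move=> [I s] [J t] /ffunP /= E.
have IJ : I = J.
  apply/val_inj/ffunP => i; apply: val_inj.
  have : [seq val (val I i) | i <- enum 'I_n] = [seq val (val J i) | i <- enum 'I_n].
    apply: (irr_sorted_eq ltn_trans ltnn); try exact: multi_index_sorted.
    move=> k; apply/mapP/mapP => -[j _ ->].
      exists (t (s^-1 j)%g); first by rewrite mem_enum.
      by have := E (s^-1 j)%g; rewrite !ffunE /= permKV => ->.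
    exists (s (t^-1 j)%g); first by rewrite mem_enum.
    by have := E (t^-1 j)%g; rewrite !ffunE /= permKV => ->.
  by move=> /eq_in_map; apply; rewrite mem_enum.
rewrite IJ in E *; congr (_, _); apply/permP => i.
by have := E i; rewrite !ffunE => /multi_index_inj.
Qed.

Lemma index_of_perm_onto (f : {ffun 'I_n -> 'I_(m + n)}) : injective f ->
  exists p, index_of_perm p = f.
Proof.
move=> finj.
(* Sorting the values of [f] produces the increasing multi-index, and [s] records the places they
   came from. *)
pose t0 := [tuple f i | i < n].
pose t := [tuple of sort (relpre val leq) t0].
have t0t : perm_eq t0 t by rewrite perm_sym perm_sort.
have [s sE] := tuple_permP t0t.
have fE i : f i = tnth t (s i).
  have : tnth t0 i = tnth [tuple tnth t (s i)  | i < n] i.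
    by congr tnth; apply: val_inj.
  by rewrite !tnth_mktuple.
have ts : sorted ltn (map val t).
  rewrite ltn_sorted_uniq_leq map_inj_uniq; last exact: val_inj.
  rewrite sort_uniq map_inj_uniq // enum_uniq /= sorted_map.
  by apply: sort_sorted => i j /=; exact: leq_total.
pose I := [ffun i => tnth t i].
have Imono : [forall i : 'I_n, forall j : 'I_n, (i < j)%N ==> (I i < I j)%N].
  apply/forallP => i; apply/forallP => j; apply/implyP => ij; rewrite !ffunE.
  rewrite !(tnth_nth (f i)) -!(nth_map (f i) 0%N val) ?size_tuple //.
  by rewrite (sorted_ltn_nth ltn_trans) // inE size_map size_tuple.
by exists (exist _ I Imono, s); apply/ffunP => i; rewrite !ffunE fE.
Qed.

Variable R : comNzRingType.

Lemma det_colsub_perm (B : 'M[R]_(n, m + n)) (I : multi_index n m) (s : 'S_n) :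
  \det (colsub (index_of_perm (I, s)) B) =
  (-1) ^+ s * \det (colsub (val I) B).
Proof.
have -> : colsub (index_of_perm (I, s)) B = col_perm s (colsub (val I) B).
  by apply/matrixP => i j; rewrite !mxE ffunE.
by rewrite col_permE det_mulmx det_perm mulrC odd_permV.
Qed.

(* Leibniz expansion gives a sum over all f : 'I_n -> 'I_(m + n); the non-injective
   f contribute 0, the others are uniquely of the form I \o s with I increasing. *)
Lemma Cauchy_Binet (A B : 'M[R]_(n, m + n)) :
  \det (A *m B^T) = \sum_(I : multi_index n m)
     \det (colsub (val I) A) * \det (colsub (val I) B).
Proof.
have -> : \det (A *m B^T) = \sum_(f : {ffun 'I_n -> 'I_(m + n)})
    (\prod_i A i (f i)) * \det (colsub f B).
  rewrite [LHS]/determinant.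
  under eq_bigr => s _.
    under eq_bigr => i _ do rewrite mxE.
    rewrite bigA_distr_bigA big_distrr /=.
    under eq_bigr => f _ do rewrite big_split /= mulrCA.
    over.
  rewrite exchange_big; apply: eq_bigr => f _ /=.
  rewrite -big_distrr /= -[in RHS]det_tr; congr (_ * _).
  apply: eq_bigr => s _; congr (_ * _); apply: eq_bigr => i _.
  by rewrite !mxE.
rewrite (bigID (fun f : {ffun _} => f \in codom index_of_perm)) /=.
rewrite [X in _ + X]big1 ?addr0 => [|f fN]; last first.
  have /injectivePn [i [j ij fij]] : ~~ injectiveb f.
    apply: contra fN => /injectiveP/index_of_perm_onto[p <-].
    exact: codom_f.
  rewrite (_ : \det _ = 0) ?mulr0 // -det_tr.
  by apply: (determinant_alternate ij) => k; rewrite !mxE fij.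
have -> (F : {ffun 'I_n -> 'I_(m + n)} -> R) :
    \sum_(f in codom index_of_perm) F f = \sum_p F (index_of_perm p).
  transitivity (\sum_(f <- codom index_of_perm) F f); last by rewrite big_image.
  by rewrite big_uniq //; exact/injectiveP/index_of_perm_inj.
rewrite -(pair_bigA _ (fun I s => \prod_i A i (index_of_perm (I, s) i) *
  \det (colsub (index_of_perm (I, s)) B))) /=.
apply: eq_bigr => I _; rewrite [X in X * _]/determinant big_distrl /=.
apply: eq_bigr => s _; rewrite det_colsub_perm mulrCA mulrA; congr (_ * _ * _).
by apply: eq_bigr => i _; rewrite !mxE ffunE.
Qed.

End CauchyBinet.

(** * Inner products of decomposable n-vectors *)

Section Wedge.
Variables (R : realType) (n m : nat).

(** Cauchy-Binet removes the multi-indices from inner products. Two independent arguments are kept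
    so that one can be differentiated while the other is frozen. *)
Lemma wedge_mulmx (A B : 'M[R]_(n, m + n)) :
  wedge A *m (wedge B)^T = (\det (A *m B^T))%:M.
Proof.
rewrite [LHS]mx11_scalar Cauchy_Binet mxE; congr _%:M.
rewrite [RHS](reindex (enum_val (A := {: multi_index n m}))) /=; last first.
  by apply: onW_bij; exact: enum_val_bij.
by apply: eq_bigr => k _; rewrite !mxE.
Qed.

Lemma wedge_scale (C : 'M[R]_n) (A : 'M[R]_(n, m + n)) :
  wedge (C *m A) = \det C *: wedge A.
Proof.
apply/rowP => k; rewrite !mxE -det_mulmx; congr (\det _).
by apply/matrixP => i j; rewrite !mxE; apply: eq_bigr => l _; rewrite !mxE.
Qed.

End Wedge.

(** * Calculus of matrix-valued maps *)

Section MatrixCalculus.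
Variables (R : realType) (V : normedModType R).
Implicit Types (x v : V).

Lemma differentiable_mx m n (f : V -> 'M[R]_(m, n)) x :
  (forall i j, differentiable (fun y => f y i j) x) -> differentiable f x.
Proof.
move=> df.
have -> : f = \sum_i \sum_j (fun y => f y i j *: delta_mx i j).
  apply/funext => y; rewrite {1}[f y]matrix_sum_delta fct_sumE.
  by apply: eq_bigr => i _; rewrite fct_sumE.
by apply: differentiable_sum => i; apply: differentiable_sum => j;
  exact: differentiableZl.
Qed.

Lemma differentiable_entry m n (f : V -> 'M[R]_(m, n)) x i j :
  differentiable f x -> differentiable (fun y => f y i j) x.
Proof.
move=> df; exact: (differentiable_comp df (differentiable_coord (f x) i j)).
Qed.

Lemma is_derive_entry m n (f : V -> 'M[R]_(m, n)) x v (df : 'M[R]_(m, n)) i j :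
  is_derive x v f df -> is_derive x v (fun y => f y i j) (df i j).
Proof.
move=> [fx <-]; apply: DeriveDef; last by rewrite derive_mx // mxE.
by have /derivable_mxP := fx; apply.
Qed.

Lemma is_derive_mx m n (f : V -> 'M[R]_(m, n)) x v (df : 'M[R]_(m, n)) :
  (forall i j, is_derive x v (fun y => f y i j) (df i j)) -> is_derive x v f df.
Proof.
move=> fx; have dfx : derivable f x v by apply/derivable_mxP => i j; have [] := fx i j.
apply: DeriveDef => //; rewrite derive_mx //.
by apply/matrixP => i j; rewrite mxE; have [] := fx i j.
Qed.

Lemma is_derive_bigsum (W : normedModType R) (I : Type) (r : seq I) (P : pred I)
    (f : I -> V -> W) (df : I -> W) x v :
  (forall i, P i -> is_derive x v (f i) (df i)) ->
  is_derive x v (fun y => \sum_(i <- r | P i) f i y) (\sum_(i <- r | P i) df i).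
Proof.
move=> fd; elim: r => [|i r IH].
  rewrite big_nil (_ : (fun _ => _) = cst 0); first exact: is_derive_cst.
  by apply/funext => y; rewrite big_nil.
rewrite big_cons; case: ifP => Pi.
  rewrite (_ : (fun _ => _) = f i + (fun y => \sum_(i <- r | P i) f i y)).
    by have := fd i Pi => ?; exact: is_deriveD.
  by apply/funext => y; rewrite big_cons Pi.
rewrite (_ : (fun _ => _) = (fun y => \sum_(i <- r | P i) f i y)) //.
by apply/funext => y; rewrite big_cons Pi.
Qed.

Lemma differentiable_bigsum (W : normedModType R) (I : Type) (r : seq I) (P : pred I)
    (f : I -> V -> W) x :
  (forall i, P i -> differentiable (f i) x) ->
  differentiable (fun y => \sum_(i <- r | P i) f i y) x.
Proof.
move=> fd; elim: r => [|i r IH].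
  rewrite (_ : (fun _ => _) = cst 0); first exact: differentiable_cst.
  by apply/funext => y; rewrite big_nil.
case Pi : (P i).
  rewrite (_ : (fun _ => _) = f i + (fun y => \sum_(i <- r | P i) f i y)).
    by apply: differentiableD => //; exact: fd.
  by apply/funext => y; rewrite big_cons Pi.
rewrite (_ : (fun _ => _) = (fun y => \sum_(i <- r | P i) f i y)) //.
by apply/funext => y; rewrite big_cons Pi.
Qed.

Lemma differentiable_bigprod (I : Type) (r : seq I) (P : pred I)
    (f : I -> V -> R) x :
  (forall i, P i -> differentiable (f i) x) ->
  differentiable (fun y => \prod_(i <- r | P i) f i y) x.
Proof.
move=> fd; elim: r => [|i r IH].
  rewrite (_ : (fun _ => _) = cst 1); first exact: differentiable_cst.
  by apply/funext => y; rewrite big_nil.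
case Pi : (P i).
  rewrite (_ : (fun _ => _) = f i * (fun y => \prod_(i <- r | P i) f i y)).
    by apply: differentiableM => //; exact: fd.
  by apply/funext => y; rewrite big_cons Pi.
rewrite (_ : (fun _ => _) = (fun y => \prod_(i <- r | P i) f i y)) //.
by apply/funext => y; rewrite big_cons Pi.
Qed.

Lemma is_derive_bigprod (I : eqType) (r : seq I) (f : I -> V -> R) df x v :
  uniq r -> (forall i, is_derive x v (f i) (df i)) ->
  is_derive x v (fun y => \prod_(i <- r) f i y)
    (\sum_(i <- r) df i * \prod_(j <- r | j != i) f j x).
Proof.
move=> + fd; elim: r => [_|i r IH /= /andP[ir ur]].
  rewrite big_nil (_ : (fun _ => _) = cst 1); first exact: is_derive_cst.
  by apply/funext => y; rewrite big_nil.
rewrite (_ : (fun _ => _) = f i * (fun y => \prod_(i <- r) f i y)); last first.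
  by apply/funext => y; rewrite big_cons.
have := IH ur; have := fd i => ? ?.
apply: is_derive_eq; rewrite /= big_cons big_cons eqxx /= addrC /GRing.scale /=.
congr (_ + _).
  rewrite mulrC; congr (_ * _); rewrite big_seq [RHS]big_seq_cond; apply: eq_bigl => j.
  by case: eqVneq => [->|_]; rewrite ?andbT // andbF (negbTE ir).
rewrite big_distrr /= !big_seq; apply: eq_bigr => j jr.
rewrite big_cons ifT; first by rewrite mulrCA.
by apply: contraNneq ir => ->.
Qed.

Lemma differentiable_mulmx m n p (f : V -> 'M[R]_(m, n)) (g : V -> 'M[R]_(n, p)) x :
  differentiable f x -> differentiable g x ->
  differentiable (fun y => f y *m g y) x.
Proof.
move=> df dg; apply: differentiable_mx => i j.
rewrite (_ : (fun _ => _) = fun y => \sum_k (f y i k * g y k j)).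
  apply: differentiable_bigsum => k _.
  by apply: (@differentiableM _ _ (fun y => f y i k) (fun y => g y k j)); exact: differentiable_entry.
by apply/funext => y; rewrite mxE.
Qed.

Lemma differentiable_trmx m n (f : V -> 'M[R]_(m, n)) x :
  differentiable f x -> differentiable (fun y => (f y)^T) x.
Proof.
move=> df; apply: differentiable_mx => i j.
rewrite (_ : (fun _ => _) = fun y => f y j i); first exact: differentiable_entry.
by apply/funext => y; rewrite mxE.
Qed.

Lemma differentiable_det n (f : V -> 'M[R]_n) x :
  differentiable f x -> differentiable (fun y => \det (f y)) x.
Proof.
move=> df; rewrite /determinant; apply: differentiable_bigsum => s _.
apply: (@differentiableM _ _ (cst _)); first exact: differentiable_cst.
by apply: differentiable_bigprod => i _; exact: differentiable_entry.
Qed.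

Lemma near_unitmx n (f : V -> 'M[R]_n) x : differentiable f x ->
  f x \in unitmx -> \forall y \near x, f y \in unitmx.
Proof.
move=> df; rewrite unitmxE unitfE => fx.
have /differentiable_continuous fc := differentiable_det df.
have := fc; move=> /cvgr_neq0 /(_ fx); apply: filterS => y.
by rewrite unitmxE unitfE.
Qed.

(** Many formulas below, such as Cramer's rule for [invmx] or the entries of a Jacobian, hold only
    near the point. Differentiability is transported through its little-o expansion. *)
Lemma near_eq_differentiable (W : normedModType R) (f g : V -> W) x :
  (\near x, f x = g x) -> differentiable f x -> differentiable g x.
Proof.
move=> fg df; have fgx : f x = g x := nbhs_singleton fg.
have [dfc fE] := (diff_locallyP _ _).1 df.
have gE : g \o shift x = cst (g x) + 'd f x +o_ 0 id.
  apply/eqaddoP => e e0; have := (eqaddoP _ _ _ _).1 fE e e0.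
  have : \forall h \near (0 : V), f (h + x) = g (h + x).
    by have := fg; rewrite (near_shift 0) /= subr0.
  apply: filterS2 => h fgh; rewrite -fgx.
  by rewrite !fctE /= fgh.
by apply/diff_locallyP; rewrite (diff_unique dfc gE).
Qed.

Lemma differentiable_invmx n (f : V -> 'M[R]_n) x : differentiable f x ->
  f x \in unitmx -> differentiable (fun y => invmx (f y)) x.
Proof.
move=> df fx.
(* Cramer's formula agrees with [invmx] where [f y] is invertible, hence for [y] near [x]. *)
apply: (@near_eq_differentiable _ (fun y => (\det (f y))^-1 *: \adj (f y))).
  by apply: filterS (near_unitmx df fx) => y fy; rewrite /invmx fy.
apply: differentiable_mx => i j.
rewrite (_ : (fun _ => _) = (fun y => (\det (f y))^-1) *
    (fun y => (-1) ^+ (j + i) * \det (row' j (col' i (f y))))); last first.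
  by apply/funext => y; rewrite !mxE.
apply: differentiableM.
  apply: differentiableV; first exact: differentiable_det.
  by move: fx; rewrite unitmxE unitfE.
apply: (@differentiableM _ _ (cst _)); first exact: differentiable_cst.
apply: differentiable_det; apply: differentiable_mx => k l.
rewrite (_ : (fun _ => _) = fun y => f y (lift j k) (lift i l)).
  exact: differentiable_entry.
by apply/funext => y; rewrite !mxE.
Qed.

Lemma is_derive_mulmx m n p (f : V -> 'M[R]_(m, n)) (g : V -> 'M[R]_(n, p)) x v df dg :
  is_derive x v f df -> is_derive x v g dg ->
  is_derive x v (fun y => f y *m g y) (df *m g x + f x *m dg).
Proof.
move=> hf hg; apply: is_derive_mx => i j.
rewrite (_ : (fun _ => _) = fun y => \sum_k (f y i k * g y k j)); last first.
  by apply/funext => y; rewrite mxE.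
rewrite !mxE -big_split /=; apply: is_derive_bigsum => k _.
have ? := is_derive_entry i k hf; have ? := is_derive_entry k j hg.
rewrite (_ : (fun _ => _) = (fun y => f y i k) * (fun y => g y k j)) //.
by apply: is_derive_eq; rewrite [RHS]addrC /GRing.scale /= (mulrC (df i k)).
Qed.

Lemma is_derive_mulmxr m n p (f : V -> 'M[R]_(m, n)) (B : 'M[R]_(n, p)) x v df :
  is_derive x v f df -> is_derive x v (fun y => f y *m B) (df *m B).
Proof.
move=> hf; have := is_derive_mulmx hf (is_derive_cst B x v).
by rewrite mulmx0 addr0.
Qed.

Lemma is_derive_mulmxl m n p (B : 'M[R]_(m, n)) (f : V -> 'M[R]_(n, p)) x v df :
  is_derive x v f df -> is_derive x v (fun y => B *m f y) (B *m df).
Proof.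
move=> hf; have := is_derive_mulmx (is_derive_cst B x v) hf.
by rewrite mul0mx add0r.
Qed.

Lemma is_derive_trmx m n (f : V -> 'M[R]_(m, n)) x v df :
  is_derive x v f df -> is_derive x v (fun y => (f y)^T) df^T.
Proof.
move=> hf; apply: is_derive_mx => i j; rewrite mxE.
rewrite (_ : (fun _ => _) = fun y => f y j i); first exact: is_derive_entry.
by apply/funext => y; rewrite mxE.
Qed.

(** Jacobi's formula: by the Leibniz expansion the derivative is the sum of the determinants
    [\det (A i)] in which only row [i] is differentiated, and expanding each along that row produces
    the adjugate. *)
Lemma is_derive_det n (f : V -> 'M[R]_n) x v df : is_derive x v f df ->
  is_derive x v (fun y => \det (f y)) (\tr (df *m \adj (f x))).
Proof.
move=> hf.
pose A i := \matrix_(k, l) if k == i then df k l else f x k l.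
have -> : \tr (df *m \adj (f x)) = \sum_i \det (A i).
  apply: eq_bigr => i _; rewrite mxE (expand_det_row _ i); apply: eq_bigr => j _.
  rewrite !mxE eqxx; congr (_ * _); rewrite /cofactor; congr (_ * \det _).
  by apply/matrixP => k l; rewrite !mxE eq_sym (negbTE (neq_lift _ _)).
rewrite /determinant exchange_big /=; apply: is_derive_bigsum => s _.
rewrite -big_distrr /=.
have := @is_derive_bigprod _ (index_enum 'I_n) (fun i y => f y i (s i)) (fun i => df i (s i)) x v
  (index_enum_uniq _) (fun i => is_derive_entry i (s i) hf).
move=> /(is_deriveZ ((-1) ^+ s)) /= h; apply: is_derive_eq.
rewrite /GRing.scale /=; congr (_ * _); apply: eq_bigr => i _.
rewrite [RHS](bigD1 i) //= mxE eqxx; congr (_ * _).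
by apply: eq_bigr => j ji; rewrite mxE (negbTE ji).
Qed.

Lemma is_derive_invmx n (f : V -> 'M[R]_n) x v df : differentiable f x ->
  f x \in unitmx -> is_derive x v f df ->
  is_derive x v (fun y => invmx (f y)) (- (invmx (f x) *m df *m invmx (f x))).
Proof.
move=> fd fx hf.
have hi : is_derive x v (fun y => invmx (f y)) ('D_v (fun y => invmx (f y)) x).
  exact/derivableP/diff_derivable/differentiable_invmx.
suff <- : 'D_v (fun y => invmx (f y)) x = - (invmx (f x) *m df *m invmx (f x)) by [].
(* Existence of the derivative being known, its value follows from the product rule applied to the
   locally constant [f y *m invmx (f y)]. *)
have h1 := is_derive_mulmx hf hi.
have h0 : is_derive x v (fun y => f y *m invmx (f y)) 0.
  apply: near_eq_is_derive (is_derive_cst (1%:M : 'M[R]_n) x v).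
  by apply: filterS (near_unitmx fd fx) => y fy; rewrite mulmxV.
have /eqP : df *m invmx (f x) + f x *m 'D_v (fun y => invmx (f y)) x = 0.
  by rewrite -[LHS](@derive_val _ _ _ _ _ _ _ h1) -[RHS](@derive_val _ _ _ _ _ _ _ h0).
rewrite addrC addr_eq0 => /eqP/(congr1 (mulmx (invmx (f x)))).
by rewrite mulKmx // mulmxN mulmxA.
Qed.

End MatrixCalculus.

(** * Symmetry of second derivatives *)

Section Schwarz.
Variables (R : realType) (V : normedModType R).
Implicit Types (x a u v w : V) (f g : V -> R).

Lemma is_derive_line g a w (t : R) : derivable g (t *: w + a) w ->
  is_derive t 1 (fun s : R => g (s *: w + a)) ('D_w g (t *: w + a)).
Proof.
move=> gd; have E : (fun h : R => h^-1 *: (g (h *: w + (t *: w + a)) - g (t *: w + a))) =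
    (fun h : R => h^-1 *: (((fun s : R => g (s *: w + a)) \o shift t) (h *: (1 : R)) - g (t *: w + a))).
  apply/funext => h /=; rewrite [h *: (1 : R)]mulr1.
  by rewrite scalerDl addrA.
apply: DeriveDef.
  by move: gd; rewrite /derivable /= E.
by rewrite /derive /= E.
Qed.

Lemma MVT_line g a w (h : R) : 0 < h ->
  (forall t, 0 <= t <= h -> derivable g (t *: w + a) w) ->
  exists2 c, 0 < c < h & g (h *: w + a) - g a = h * 'D_w g (c *: w + a).
Proof.
move=> h0 gd.
have [t||c] := @MVT R (fun s : R => g (s *: w + a)) (fun t => 'D_w g (t *: w + a)) 0 h h0.
- by rewrite in_itv /= => /andP[t0 th]; apply/is_derive_line/gd; rewrite !ltW.
- apply: derivable_within_continuous => t; rewrite in_itv /= => th.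
  by have [] := is_derive_line (gd t th).
- by rewrite in_itv /= => ch; rewrite scale0r add0r subr0 mulrC => E; exists c.
Qed.

(** Two uses of the mean value theorem: along [u] for the increment [g] of [f] in the direction [v],
    then along [v] for ['D_u f]. The left-hand side of the equation is symmetric in [u] and [v], the
    right-hand side is not. *)
Lemma second_difference f x u v (h : R) : 0 < h ->
  (forall s t, 0 <= s <= h -> 0 <= t <= h ->
    derivable f (s *: u + (t *: v + x)) u /\
    derivable ('D_u f) (s *: u + (t *: v + x)) v) ->
  exists c d, [/\ 0 < c < h, 0 < d < h &
    f (h *: u + (h *: v + x)) - f (h *: u + x) - f (h *: v + x) + f x =
    h ^+ 2 * 'D_v ('D_u f) (c *: u + (d *: v + x))].
Proof.
move=> h0 fd; have hh : 0 <= h <= h by rewrite lexx ltW.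
have zh : 0 <= (0 : R) <= h by rewrite lexx ltW.
pose g y := f (h *: v + y) - f y.
have shiftE (k : V -> R) w y :
    (fun t : R => t^-1 *: (k (h *: v + (t *: w + y)) - k (h *: v + y))) =
    (fun t : R => t^-1 *: (k (t *: w + (h *: v + y)) - k (h *: v + y))).
  by apply/funext => t; rewrite addrCA.
have dshift y : derivable f (h *: v + y) u ->
    is_derive y u (fun z => f (h *: v + z)) ('D_u f (h *: v + y)).
  move=> fy; apply: DeriveDef; first by move: fy; rewrite /derivable /= shiftE.
  by rewrite /derive /= shiftE.
have dg t : 0 <= t <= h ->
    is_derive (t *: u + x) u g ('D_u f (h *: v + (t *: u + x)) - 'D_u f (t *: u + x)).
  move=> th; have [f1 _] := fd t h th hh; have [f0 _] := fd t 0 th zh.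
  rewrite scale0r add0r in f0; rewrite addrCA in f1.
  by apply: is_deriveB; [exact: dshift|exact: derivableP].
have [t th|c ch gE] := @MVT_line g x u h h0; first by have [] := dg t th.
have ch' : 0 <= c <= h by case/andP: ch => *; rewrite !ltW.
have [t th|d dh dE] := @MVT_line ('D_u f) (c *: u + x) v h h0.
  by have [_] := fd c t ch' th; rewrite addrCA.
exists c, d; split; [exact: ch|exact: dh|].
rewrite [c *: u + _]addrCA expr2 -mulrA -dE.
have [_ dgc] := dg c ch'; rewrite -dgc -gE /g.
rewrite [h *: v + (h *: u + x)]addrCA. by rewrite opprB [RHS]addrA [RHS]addrAC.
Qed.

(** The symmetry of the second difference makes the two mixed derivatives take the same value at two
    points close to [x]; continuity then compares their values at [x] up to any [e]. *)
Lemma Schwarz f x u v (U : set V) : open U -> U x ->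
  (forall y, U y -> [/\ derivable f y u, derivable f y v,
    derivable ('D_u f) y v & derivable ('D_v f) y u]) ->
  {for x, continuous ('D_v ('D_u f))} -> {for x, continuous ('D_u ('D_v f))} ->
  'D_v ('D_u f) x = 'D_u ('D_v f) x.
Proof.
move=> Uo Ux fd cvu cuv.
apply/eqP; rewrite -subr_eq0 -normr_eq0; apply/eqP/le_anti; rewrite normr_ge0 andbT.
apply/ler_addgt0Pl => e e0; rewrite addr0.
have e2 : 0 < e / 2 by rewrite divr_gt0.
have nU : \forall y \near x, U y by apply: open_nbhs_nbhs; split.
have nvu : \forall y \near x, `|'D_v ('D_u f) x - 'D_v ('D_u f) y| < e / 2.
  by have /cvgrPdist_lt/(_ _ e2) := cvu.
have nuv : \forall y \near x, `|'D_u ('D_v f) x - 'D_u ('D_v f) y| < e / 2.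
  by have /cvgrPdist_lt/(_ _ e2) := cuv.
have [r /= r0 xr] := (nbhs_ballP _ _).1 (filterI nU (filterI nvu nuv)).
(* Steps of length at most [h] along [u] and [v] move [x] by at most [r / 2]; the summand 1 covers
   [u = v = 0]. *)
pose h := r / (2 * (`|u| + `|v| + 1)).
have uv0 : 0 < `|u| + `|v| + 1 by rewrite ltr_wpDl // addr_ge0.
have h0 : 0 < h by rewrite divr_gt0 // mulr_gt0.
have near_x s t : 0 <= s <= h -> 0 <= t <= h -> ball x r (s *: u + (t *: v + x)).
  move=> /andP[s0 sh] /andP[t0 th]; rewrite -ball_normE /ball_ /= addrA.
  rewrite opprD addrCA subrr addr0 normrN (le_lt_trans (ler_normD _ _)) //.
  rewrite !normrZ (ger0_norm s0) (ger0_norm t0).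
  have h2 : h * (`|u| + `|v| + 1) = r / 2.
    by rewrite /h; field; rewrite gt_eqF.
  apply: (@le_lt_trans _ _ (h * (`|u| + `|v| + 1))); last by rewrite h2; lra.
  rewrite mulrDr mulrDr -[leLHS]addr0 !lerD ?ler_wpM2r // mulr1 ltW //.
have bnd s : 0 < s < h -> 0 <= s <= h by case/andP => *; rewrite !ltW.
have [s t sh th|c [d [ch dh E]]] := @second_difference f x u v h h0.
  by have [/fd[] ? ? ? ? _] := xr _ (near_x s t sh th).
have [s t sh th|c' [d' [ch' dh' E']]] := @second_difference f x v u h h0.
  by have := near_x t s th sh; rewrite addrCA => /xr[/fd[] ? ? ? ? _].
have EE : 'D_v ('D_u f) (c *: u + (d *: v + x)) =
          'D_u ('D_v f) (c' *: v + (d' *: u + x)).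
  apply: (@mulfI _ (h ^+ 2)); first by rewrite expf_neq0 // gt_eqF.
  by rewrite -E -E' [in RHS]addrCA; congr (_ + _); rewrite addrAC.
have [_ [+ _]] := xr _ (near_x c d (bnd _ ch) (bnd _ dh)).
have := near_x d' c' (bnd _ dh') (bnd _ ch'); rewrite addrCA => /xr[_ [_]].
rewrite EE => B A.
apply: le_trans (ler_distD ('D_u ('D_v f) (c' *: v + (d' *: u + x))) _ _) _.
rewrite (splitr e); apply: lerD; apply: ltW; first exact: A.
by rewrite distrC; exact: B.
Unshelve. all: by end_near. Qed.

End Schwarz.

Section Smooth.
Variables (R : realType) (V W : normedModType R).
Implicit Types (U : set V).

Lemma smooth_on_differentiable U (f : V -> W) x :
  smooth_on U f -> U x -> differentiable f x.
Proof. by move=> /(_ 1%N)[+ _]; apply. Qed.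

Lemma smooth_on_derive U (f : V -> W) v : smooth_on U f -> smooth_on U ('D_v f).
Proof. by move=> fs k; have [_] := fs k.+1; apply. Qed.

Lemma smooth_on_continuous U (f : V -> W) x :
  smooth_on U f -> U x -> {for x, continuous f}.
Proof. by move=> /(_ 0%N); apply. Qed.

End Smooth.

(** The mean value theorem is scalar, so the claim is checked entrywise. Taking an entry commutes
    with derivatives only at points of [U], hence the passage through neighbourhoods for second
    derivatives. *)
Lemma Schwarz_smooth (R : realType) (V : normedModType R) N (U : set V)
    (f : V -> 'rV[R]_N) u v x : open U -> smooth_on U f -> U x ->
  'D_v ('D_u f) x = 'D_u ('D_v f) x.
Proof.
move=> Uo fs Ux; apply/rowP => j.
have dE (g : V -> 'rV[R]_N) w y : smooth_on U g -> U y ->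
    'D_w g y 0 j = 'D_w (fun z => g z 0 j) y /\ derivable (fun z => g z 0 j) y w.
  move=> gs Uy; have gd : derivable g y w by exact/diff_derivable/(smooth_on_differentiable gs Uy).
  rewrite derive_mx // mxE; split => //.
  by have /derivable_mxP := gd; apply.
have nearU : \forall y \near x, U y by exact: open_nbhs_nbhs.
have ddE w1 w2 y : U y ->
    'D_w2 ('D_w1 f) y 0 j = 'D_w2 ('D_w1 (fun z => f z 0 j)) y.
  move=> Uy; rewrite (dE _ _ _ (smooth_on_derive w1 fs) Uy).1.
  apply: near_eq_derive; have : \forall y \near y, U y by exact: open_nbhs_nbhs.
  by apply: filterS => z Uz; rewrite (dE _ _ _ fs Uz).1.
have ddd w1 w2 y : U y -> derivable ('D_w1 (fun z => f z 0 j)) y w2.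
  move=> Uy; have [_] := dE _ w2 _ (smooth_on_derive w1 fs) Uy.
  apply: near_eq_derivable; have : \forall y \near y, U y by exact: open_nbhs_nbhs.
  by apply: filterS => z Uz; rewrite (dE _ _ _ fs Uz).1.
have ddc w1 w2 : {for x, continuous ('D_w2 ('D_w1 (fun z => f z 0 j)))}.
  have fc : {for x, continuous ('D_w2 ('D_w1 f))}.
    exact: smooth_on_continuous (smooth_on_derive w2 (smooth_on_derive w1 fs)) Ux.
  have : {for x, continuous (fun y => 'D_w2 ('D_w1 f) y 0 j)}.
    apply: (@continuous_comp _ _ _ ('D_w2 ('D_w1 f)) (fun M : 'rV[R]_N => M 0 j)).
      exact: fc.
    exact: coord_continuous.
  move=> kc; rewrite /prop_for /continuous_at -(ddE w1 w2 x Ux).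
  apply: cvg_trans kc; apply: near_eq_cvg.
  by apply: filterS nearU => y Uy; exact: ddE.
apply: etrans (ddE u v x Ux) _; apply: etrans _ (esym (ddE v u x Ux)).
apply: (@Schwarz _ _ _ x u v U Uo Ux); [|exact: ddc|exact: ddc].
move=> y Uy; split; [exact: (dE _ u _ fs Uy).2|exact: (dE _ v _ fs Uy).2| |].
  exact: ddd.
exact: ddd.
Qed.

(** * The Pluecker embedding in a chart *)

Section Misc.
Variable R : realType.

(** The Koszul formula with lowered index determines the symbols of a nondegenerate metric, so a
    guessed [c] can be verified without inverting [g]. It serves both the Grassmannian and the
    induced metric. *)
Lemma christoffel_unique n (g : 'rV[R]_n -> 'M[R]_n) x (c : 'rV[R]_n) i j k :
  g x \in unitmx -> (g x)^T = g x ->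
  (forall l, (c *m g x) 0 l = 2^-1 * (pderiv i (fun y => g y j l) x
     + pderiv j (fun y => g y i l) x - pderiv l (fun y => g y i j) x)) ->
  christoffel g x k i j = c 0 k.
Proof.
move=> gu gs cE; rewrite -[c in RHS](mulmxK gu) mxE /christoffel big_distrr /=.
apply: eq_bigr => l _; rewrite cE mulrCA mulrC; congr (_ * _).
by rewrite -[in LHS]gs -trmx_inv mxE.
Qed.

Lemma adj_unit n (A : 'M[R]_n) : A \in unitmx -> \adj A = \det A *: invmx A.
Proof.
move=> Au; rewrite /invmx Au scalerA mulfV ?scale1r //.
by move: Au; rewrite unitmxE unitfE.
Qed.

Lemma is_derive_det_unit (V : normedModType R) n (f : V -> 'M[R]_n) x v (df : 'M[R]_n) :
  is_derive x v f df -> f x \in unitmx ->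
  is_derive x v (fun y => \det (f y)) (\det (f x) * \tr (invmx (f x) *m df)).
Proof.
move=> /is_derive_det h fu; apply: is_derive_eq.
by rewrite adj_unit // -scalemxAr linearZ /= mxtrace_mulC.
Qed.

Lemma is_derive_mxtrace (V : normedModType R) n (f : V -> 'M[R]_n) x v (df : 'M[R]_n) :
  is_derive x v f df -> is_derive x v (fun y => \tr (f y)) (\tr df).
Proof. by move=> h; apply: is_derive_bigsum => i _; exact: is_derive_entry. Qed.

Lemma differentiable_vec_mx n m (x : 'rV[R]_(n * m)) :
  differentiable (fun y : 'rV[R]_(n * m) => vec_mx y) x.
Proof.
apply: differentiable_mx => i j.
rewrite (_ : (fun _ => _) = fun y : 'rV[R]_(n * m) => y 0 (mxvec_index i j)).
  exact: differentiable_coord.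
by apply/funext => y; rewrite mxE.
Qed.

Lemma is_derive_vec_mx n m (x v : 'rV[R]_(n * m)) :
  is_derive x v (fun y : 'rV[R]_(n * m) => vec_mx y) (vec_mx v).
Proof.
apply: is_derive_mx => i j; rewrite mxE.
rewrite (_ : (fun _ => _) = fun y : 'rV[R]_(n * m) => id y 0 (mxvec_index i j)).
  by apply: is_derive_entry; exact: is_derive_id.
by apply/funext => y; rewrite mxE.
Qed.

Lemma det_gram_gt0 n N (E : 'M[R]_(n, N)) : row_free E -> 0 < \det (E *m E^T).
Proof.
move=> Ef; have [C C0 CE] := row_free_orthonormalize Ef.
have : \det C ^+ 2 * \det (E *m E^T) = 1.
  rewrite expr2 mulrAC -[X in _ * X]det_tr -!det_mulmx -(det1 R n) -CE.
  by rewrite trmx_mul !mulmxA.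
move=> H; have : 0 < \det C ^+ 2 * \det (E *m E^T) by rewrite H.
by rewrite pmulr_rgt0 // exprn_gt0.
Qed.

Lemma det_graph_gt0 n m (z : 'M[R]_(n, m)) : 0 < \det (1%:M + z *m z^T).
Proof.
have := @det_gram_gt0 n (n + m) (row_mx 1%:M z).
rewrite tr_row_mx mul_row_col trmx1 mulmx1; apply; apply/row_freeP.
by exists (col_mx 1%:M 0); rewrite mul_row_col mulmx1 mulmx0 addr0.
Qed.

Lemma gram_graph_unit n m (z : 'M[R]_(n, m)) : 1%:M + z *m z^T \in unitmx.
Proof. by rewrite unitmxE unitfE gt_eqF // det_graph_gt0. Qed.

End Misc.

Section Plucker.
Variables (R : realType) (n m : nat).

(** For an orthonormal basis [C *m E] of the same orientation, the Gram determinant forces [\det C]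
    to be the positive root, so every choice allowed in [plucker] has the same wedge. *)
Lemma plucker_oriented_span (E : 'M[R]_(n, m + n)) : row_free E ->
  plucker (oriented_span E) = (Num.sqrt (\det (E *m E^T)))^-1 *: wedge E.
Proof.
move=> Ef; have d0 := det_gram_gt0 Ef.
have detC (C : 'M[R]_n) : 0 < \det C -> (C *m E) *m (C *m E)^T = 1%:M ->
    wedge (C *m E) = (Num.sqrt (\det (E *m E^T)))^-1 *: wedge E.
  move=> C0 CE; rewrite wedge_scale; congr (_ *: _).
  have : \det C ^+ 2 * \det (E *m E^T) = 1.
    rewrite expr2 mulrAC -[X in _ * X]det_tr -!det_mulmx -(det1 R n) -CE.
    by rewrite trmx_mul !mulmxA.
  move=> /(congr1 Num.sqrt); rewrite sqrtr1 sqrtrM ?sqr_ge0 // sqrtr_sqr gtr0_norm // => H.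
  apply: (@mulIf _ (Num.sqrt (\det (E *m E^T)))); first by rewrite gt_eqF // sqrtr_gt0.
  by rewrite H mulVf // gt_eqF // sqrtr_gt0.
have [C C0 CE] := row_free_orthonormalize Ef.
rewrite /plucker; case: xgetP => [w _ [_ [[D /= D0 <-] DE] <-]|]; first exact: detC.
move=> /(_ (wedge (C *m E))) []; exists (C *m E) => //; split => //.
by exists C.
Qed.

Variable Q : {Q : 'M[R]_(m + n) | Q *m Q^T = 1%:M}.
Let nu := usubmx (sval Q).
Let e := dsubmx (sval Q).

Lemma frame_gram : [/\ nu *m nu^T = 1%:M, nu *m e^T = 0, e *m nu^T = 0 & e *m e^T = 1%:M].
Proof.
have := svalP Q; rewrite -{1 2}(vsubmxK (sval Q)) tr_col_mx mul_col_row.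
by rewrite [RHS]scalar_mx_block => /eq_block_mx.
Qed.

Lemma graph_gram (z w : 'M[R]_(n, m)) :
  (e + z *m nu) *m (e + w *m nu)^T = 1%:M + z *m w^T.
Proof.
have [nn ne en ee] := frame_gram.
rewrite linearD /= trmx_mul mulmxDl !mulmxDr ee mulmxA en mul0mx addr0.
by rewrite -[z *m nu *m e^T]mulmxA ne mulmx0 add0r mulmxA -(mulmxA z) nn mulmx1.
Qed.

Lemma graph_row_free (z : 'M[R]_(n, m)) : row_free (e + z *m nu).
Proof.
have [nn ne en ee] := frame_gram; apply/row_freeP; exists e^T.
by rewrite mulmxDl ee -mulmxA ne mulmx0 addr0.
Qed.

Let phi := @plucker R n m \o grass_inv Q.
Let s (z : 'rV[R]_(n * m)) := (Num.sqrt (\det (1%:M + vec_mx z *m (vec_mx z)^T)))^-1.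

Lemma pluckerE z : phi z = s z *: wedge (e + vec_mx z *m nu).
Proof. by rewrite /phi /= plucker_oriented_span ?graph_row_free // graph_gram. Qed.

(** The induced metric is the mixed derivative of this kernel on the diagonal, which spares all
    computation with individual Pluecker coordinates. *)
Lemma plucker_inner z w :
  phi z *m (phi w)^T = (s z * s w * \det (1%:M + vec_mx z *m (vec_mx w)^T))%:M.
Proof.
rewrite !pluckerE linearZ /= -scalemxAl -scalemxAr scalerA wedge_mulmx graph_gram.
by rewrite scale_scalar_mx.
Qed.

Lemma differentiable_plucker_scale z : differentiable s z.
Proof.
have d0 := det_graph_gt0 (vec_mx z).
apply: differentiableV; last by rewrite gt_eqF // sqrtr_gt0.
apply: (@differentiable_comp _ _ _ _ (fun z => \det (1%:M + vec_mx z *m (vec_mx z)^T)) Num.sqrt).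
  apply: differentiable_det; apply: (@differentiableD _ _ _ (cst _)).
    exact: differentiable_cst.
  apply: differentiable_mulmx; first exact: differentiable_vec_mx.
  exact/differentiable_trmx/differentiable_vec_mx.
by apply/derivable1_diffP; have [] := is_derive1_sqrt d0.
Qed.

Lemma differentiable_plucker z : differentiable phi z.
Proof.
rewrite (_ : phi = fun z => s z *: wedge (e + vec_mx z *m nu)); last first.
  by apply/funext => y; exact: pluckerE.
apply: differentiable_mx => i j.
rewrite (_ : (fun _ => _) = s * (fun y => wedge (e + vec_mx y *m nu) i j)); last first.
  by apply/funext => y; rewrite mxE.
apply: differentiableM; first exact: differentiable_plucker_scale.
rewrite (_ : (fun _ => _) = fun y => \det (colsub (val (enum_val j : multi_index n m))
    (e + vec_mx y *m nu))); last by apply/funext => y; rewrite mxE.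
have dE : differentiable (fun y : 'rV[R]_(n * m) => e + vec_mx y *m nu) z.
  apply: (@differentiableD _ _ _ (cst _)); first exact: differentiable_cst.
  apply: differentiable_mulmx; first exact: differentiable_vec_mx.
  exact: differentiable_cst.
apply: differentiable_det; apply: differentiable_mx => k l.
rewrite (_ : (fun _ => _) = fun y => (e + vec_mx y *m nu) k
    (val (enum_val j : multi_index n m) l)); first exact: differentiable_entry.
by apply/funext => y; rewrite mxE.
Qed.

End Plucker.

(** * The Levi-Civita connection of the Grassmannian *)

Section GramInverse.
Variable R : realType.

(** At [z^T] it is the inverse of [1 + z^T z], so one definition covers both factors of the
    metric. *)
Definition gram_inv n m (z : 'M[R]_(n, m)) : 'M[R]_n := invmx (1%:M + z *m z^T).

Lemma gram_inv_tr n m (z : 'M[R]_(n, m)) : (gram_inv z)^T = gram_inv z.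
Proof. by rewrite /gram_inv trmx_inv linearD /= trmx1 trmx_mul trmxK. Qed.

Lemma gram_inv_push n m (z : 'M[R]_(n, m)) : z *m gram_inv z^T = gram_inv z *m z.
Proof.
have zu := gram_graph_unit z; have := gram_graph_unit z^T; rewrite trmxK => zTu.
apply: (can_inj (mulKmx zu)); rewrite /gram_inv mulKVmx //.
rewrite mulmxA mulmxDl mul1mx trmxK.
have -> : z + z *m z^T *m z = z *m (1%:M + z^T *m z) by rewrite mulmxDr mulmx1 mulmxA.
by rewrite -mulmxA mulmxV ?mulmx1.
Qed.

Lemma gram_inv_push_tr n m (z : 'M[R]_(n, m)) : z^T *m gram_inv z = gram_inv z^T *m z^T.
Proof. by rewrite -[z in gram_inv z]trmxK gram_inv_push. Qed.

(** The Woodbury identity. It merges the two traces of the mixed derivative into one product, which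
    is how the second factor of the metric arises. *)
Lemma gram_inv_trE n m (z : 'M[R]_(n, m)) :
  gram_inv z^T = 1%:M - z^T *m gram_inv z *m z.
Proof.
have := gram_graph_unit z^T; rewrite trmxK => zTu.
rewrite gram_inv_push_tr -mulmxA; apply/eqP; rewrite eq_sym subr_eq; apply/eqP.
by rewrite -{1}[gram_inv _]mulmx1 -mulmxDr /gram_inv trmxK mulVmx.
Qed.

End GramInverse.

Section GrassMetric.
Variables (R : realType) (n m : nat).
Variable Q : {Q : 'M[R]_(m + n) | Q *m Q^T = 1%:M}.
Let phi := @plucker R n m \o grass_inv Q.
Let s (z : 'rV[R]_(n * m)) := (Num.sqrt (\det (1%:M + vec_mx z *m (vec_mx z)^T)))^-1.

Lemma mxtrace_gram (K : 'M[R]_n) (P Z : 'M[R]_(n, m)) : K^T = K ->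
  \tr (K *m (Z *m P^T)) = \tr (K *m (P *m Z^T)).
Proof. by move=> Ks; rewrite -mxtrace_tr !trmx_mul trmxK Ks mxtrace_mulC. Qed.

Lemma is_derive_pairing (z p w : 'rV[R]_(n * m)) :
  is_derive z p (fun y => 1%:M + vec_mx y *m (vec_mx w)^T) (vec_mx p *m (vec_mx w)^T).
Proof.
have h := is_derive_mulmx (is_derive_vec_mx z p) (is_derive_cst ((vec_mx w)^T : 'M[R]_(m, n)) z p).
have := is_deriveD (is_derive_cst (1%:M : 'M[R]_n) z p) h.
by rewrite mulmx0 add0r addr0.
Qed.

Lemma is_derive_pairingr (z p w : 'rV[R]_(n * m)) :
  is_derive z p (fun y => 1%:M + vec_mx w *m (vec_mx y)^T) (vec_mx w *m (vec_mx p)^T).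
Proof.
have h := is_derive_mulmx (is_derive_cst (vec_mx w : 'M[R]_(n, m)) z p)
  (is_derive_trmx (is_derive_vec_mx z p)).
have := is_deriveD (is_derive_cst (1%:M : 'M[R]_n) z p) h.
by rewrite mul0mx !add0r.
Qed.

Lemma is_derive_graph_gram (z p : 'rV[R]_(n * m)) :
  is_derive z p (fun y => 1%:M + vec_mx y *m (vec_mx y)^T)
    (vec_mx p *m (vec_mx z)^T + vec_mx z *m (vec_mx p)^T).
Proof.
have h := is_derive_mulmx (is_derive_vec_mx z p) (is_derive_trmx (is_derive_vec_mx z p)).
have := is_deriveD (is_derive_cst (1%:M : 'M[R]_n) z p) h.
by rewrite add0r.
Qed.

(** Differentiating the constant [s * s * d = 1] gives the value without differentiating the square
    root. *)
Lemma is_derive_plucker_scale (z p : 'rV[R]_(n * m)) :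
  is_derive z p s (- s z * \tr (gram_inv (vec_mx z) *m (vec_mx p *m (vec_mx z)^T))).
Proof.
set t := \tr _; pose d (z : 'rV[R]_(n * m)) := \det (1%:M + vec_mx z *m (vec_mx z)^T).
have d0 y : 0 < d y := det_graph_gt0 (vec_mx y).
have s0 y : s y != 0.
  by apply/invr_neq0/lt0r_neq0; rewrite sqrtr_gt0; exact: d0.
have ssd y : s y * s y * d y = 1.
  rewrite /s -invfM -expr2 sqr_sqrtr; first exact/mulVf/lt0r_neq0/d0.
  exact/ltW/d0.
have dd : is_derive z p d (d z * (2 * t)).
  have := is_derive_det_unit (is_derive_graph_gram z p) (gram_graph_unit (vec_mx z)).
  rewrite -/(gram_inv (vec_mx z)) mulmxDr linearD /= (mxtrace_gram (vec_mx p) (vec_mx z) (gram_inv_tr _)).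
  by rewrite -/t mulr_natl mulr2n.
have ds : is_derive z p s ('D_p s z) by exact/derivableP/diff_derivable/differentiable_plucker_scale.
suff <- : 'D_p s z = - s z * t by [].
have h1 : is_derive z p (s * s * d) 0.
  by rewrite (_ : s * s * d = cst 1); [exact: is_derive_cst|apply/funext => y; exact: ssd].
have h2 := is_deriveM (is_deriveM ds ds) dd.
have : (s z * s z) * (d z * (2 * t)) + d z * (s z * 'D_p s z + s z * 'D_p s z) = 0.
  by rewrite -[RHS](@derive_val _ _ _ _ _ _ _ h1) -[LHS](@derive_val _ _ _ _ _ _ _ h2).
have d0z : d z != 0 by exact: lt0r_neq0.
set D := 'D_p s z => E.
apply: (mulfI (s0 z)); apply: (mulfI d0z); apply: (@mulfI _ 2); first by rewrite pnatr_eq0.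
apply/eqP; rewrite -subr_eq0; apply/eqP; rewrite -[RHS]E; ring.
Qed.

(* Differentiating <phi z, phi w> in z only; at w = z the right-hand factor
   vanishes, so that a second differentiation, in w, needs no derivative of the
   left-hand one. *)
Lemma plucker_derive_inner (z p w : 'rV[R]_(n * m)) :
  1%:M + vec_mx z *m (vec_mx w)^T \in unitmx ->
  ('D_p phi z *m (phi w)^T) 0 0 = (phi z *m (phi w)^T) 0 0 *
    (\tr (invmx (1%:M + vec_mx z *m (vec_mx w)^T) *m (vec_mx p *m (vec_mx w)^T)) -
     \tr (gram_inv (vec_mx z) *m (vec_mx p *m (vec_mx z)^T))).
Proof.
move=> zw.
have dphi : is_derive z p phi ('D_p phi z).
  exact/derivableP/diff_derivable/differentiable_plucker.
have h1 := is_derive_entry 0 0 (is_derive_mulmx dphi (is_derive_cst ((phi w)^T) z p)).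
have := @derive_val _ _ _ _ _ _ _ h1; rewrite mulmx0 addr0 => <-.
pose k y := s y * (s w * \det (1%:M + vec_mx y *m (vec_mx w)^T)).
have -> : (fun y => (phi y *m cst (phi w)^T y) 0 0) = k.
  by apply/funext => y; rewrite plucker_inner mxE mulr1n /k mulrA.
have h2 := is_deriveM (is_derive_plucker_scale z p)
  (is_deriveZ (s w) (is_derive_det_unit (is_derive_pairing z p w) zw)).
rewrite [LHS](@derive_val _ _ _ _ _ _ _ h2) plucker_inner mxE mulr1n.
rewrite /GRing.scale /= -/(s z) -/(s w) [s w *: _]mulrC; ring.
Qed.

Lemma grass_metricE (z p q : 'rV[R]_(n * m)) :
  p *m grass_metric R n m Q z *m q^T =
  (\tr (gram_inv (vec_mx z) *m vec_mx p *m gram_inv (vec_mx z)^T *m (vec_mx q)^T))%:M.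
Proof.
have dphi v : is_derive z v phi ('D_v phi z).
  exact/derivableP/diff_derivable/differentiable_plucker.
rewrite /grass_metric /induced_metric mulmxA -mulmxA -trmx_mul.
rewrite -!deriveEjacobian; try exact: differentiable_plucker.
rewrite [LHS]mx11_scalar; congr _%:M.
have h1 := is_derive_entry 0 0 (is_derive_mulmx (is_derive_cst ('D_p phi z) z q) (is_derive_trmx (dphi q))).
have := @derive_val _ _ _ _ _ _ _ h1; rewrite mul0mx add0r => <-.
have zu := gram_graph_unit (vec_mx z).
have pd : differentiable (fun y : 'rV[R]_(n * m) => 1%:M + vec_mx z *m (vec_mx y)^T) z.
  apply: (@differentiableD _ _ _ (cst _)); first exact: differentiable_cst.
  apply: differentiable_mulmx; first exact: differentiable_cst.
  exact/differentiable_trmx/differentiable_vec_mx.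
pose k y := (phi z *m (phi y)^T) 0 0.
pose r (y : 'rV[R]_(n * m)) := \tr (invmx (1%:M + vec_mx z *m (vec_mx y)^T) *m (vec_mx p *m (vec_mx y)^T)) -
     \tr (gram_inv (vec_mx z) *m (vec_mx p *m (vec_mx z)^T)).
(* The formula for the first derivative needs an invertible pairing matrix, which is available only
   near the diagonal. *)
rewrite (@near_eq_derive _ _ _ _ (k * r)); last first.
  by apply: filterS (near_unitmx pd zu) => y yu; exact: plucker_derive_inner.
have dk : is_derive z q k ('D_q k z).
  apply/derivableP.
  by have [] := is_derive_entry 0 0 (is_derive_mulmx (is_derive_cst (phi z) z q) (is_derive_trmx (dphi q))).
have pw := is_derive_mulmx (is_derive_cst (vec_mx p : 'M[R]_(n, m)) z q)
  (is_derive_trmx (is_derive_vec_mx z q)).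
set Z := vec_mx z; set P := vec_mx p; set W := vec_mx q; set K := gram_inv Z.
have dr : is_derive z q r (\tr (K *m (P *m W^T)) - \tr (K *m (Z *m W^T) *m K *m (P *m Z^T))).
  have := is_deriveB (is_derive_mxtrace (is_derive_mulmx
    (is_derive_invmx pd zu (is_derive_pairingr z q z)) pw))
    (is_derive_cst (\tr (gram_inv (vec_mx z) *m (vec_mx p *m (vec_mx z)^T))) z q).
  move=> /is_derive_eq; apply.
  rewrite subr0 mul0mx add0r mulNmx linearD /= linearN /= addrC //.
have kz : k z = 1.
  rewrite /k plucker_inner mxE mulr1n /s -invfM -expr2 sqr_sqrtr.
    exact/mulVf/lt0r_neq0/det_graph_gt0.
  exact/ltW/det_graph_gt0.
have rz : r z = 0 by rewrite /r /gram_inv subrr.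
have h2 := is_deriveM dk dr.
rewrite (@derive_val _ _ _ _ _ _ _ h2) rz scale0r addr0 kz scale1r.
rewrite gram_inv_trE -/Z -/K mulmxBr mulmx1 mulmxBl linearB /= !mulmxA; congr (_ - _).
by have := mxtrace_mulC (K *m Z *m W^T) (K *m P *m Z^T); rewrite !mulmxA.
Qed.

Lemma grass_metric_sym (z : 'rV[R]_(n * m)) : (grass_metric R n m Q z)^T = grass_metric R n m Q z.
Proof. by rewrite /grass_metric /induced_metric trmx_mul trmxK. Qed.

(** Pairing with elementary matrices reads off the entries of [gram_inv Z *m P *m gram_inv Z^T],
    whose outer factors are invertible. *)
Lemma grass_metric_unit (z : 'rV[R]_(n * m)) : grass_metric R n m Q z \in unitmx.
Proof.
rewrite -row_free_unit -kermx_eq0; apply/rowV0P => p /sub_kermxP p0.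
suff P0 : vec_mx p = 0 by rewrite -[p]vec_mxK P0 linear0.
set Z := vec_mx z; set P := vec_mx p.
have KPL : gram_inv Z *m P *m gram_inv Z^T = 0.
  apply/matrixP => i j; rewrite [RHS]mxE.
  have := grass_metricE z p (mxvec (delta_mx i j)); rewrite p0 mul0mx mxvecK.
  move=> /matrixP/(_ 0 0); rewrite mxE [RHS]mxE mulr1n -/Z -/P => ->.
  rewrite trmx_delta /mxtrace (bigD1 i) //= [X in _ + X]big1 ?addr0 => [|k ki]; last first.
    by rewrite mxE big1 // => l _; rewrite [delta_mx _ _ _ _]mxE (negbTE ki) andbF mulr0.
  rewrite [in RHS]mxE (bigD1 j) //= [X in _ + X]big1 ?addr0 => [|l lj].
    by rewrite [delta_mx _ _ _ _]mxE !eqxx mulr1.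
  by rewrite [delta_mx _ _ _ _]mxE (negbTE lj) mulr0.
have Ku' n' m' (z' : 'M[R]_(n', m')) : gram_inv z' \in unitmx.
  by rewrite unitmx_inv gram_graph_unit.
apply: (can_inj (mulKmx (Ku' _ _ Z))); rewrite mulmx0.
by apply: (can_inj (mulmxK (Ku' _ _ Z^T))); rewrite KPL mul0mx.
Qed.

Definition graph_form (Z A B : 'M[R]_(n, m)) : R :=
  \tr (gram_inv Z *m A *m gram_inv Z^T *m B^T).

Definition graph_christoffel (Z A B : 'M[R]_(n, m)) : 'M[R]_(n, m) :=
  - (A *m Z^T *m gram_inv Z *m B + B *m Z^T *m gram_inv Z *m A).

(** The derivative of [graph_form] in [Z] along [C], one term per inverse Gram factor. As a closed
    formula it reduces the Koszul identity to trace algebra. *)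
Definition graph_form_derive (Z C A B : 'M[R]_(n, m)) : R :=
  - \tr (gram_inv Z *m (C *m Z^T + Z *m C^T) *m gram_inv Z *m A *m gram_inv Z^T *m B^T)
  - \tr (gram_inv Z *m A *m gram_inv Z^T *m (C^T *m Z + Z^T *m C) *m gram_inv Z^T *m B^T).

(** Pushing [Z] through the inverse Gram matrices leaves a single [L] in every trace ([e1], [e2]);
    transposition and cyclicity identify the remaining words ([e3]), in which the identity is
    linear. *)
Lemma graph_Koszul (Z A B C : 'M[R]_(n, m)) :
  graph_form Z (graph_christoffel Z A B) C =
  2^-1 * (graph_form_derive Z A B C + graph_form_derive Z B A C - graph_form_derive Z C A B).
Proof.
rewrite /graph_form_derive /graph_form /graph_christoffel.
have Ks := gram_inv_tr Z; have Ls := gram_inv_tr Z^T.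
have ZL := gram_inv_push Z; have ZK := gram_inv_push_tr Z.
move: Ks Ls ZL ZK; move: (gram_inv Z) (gram_inv Z^T) => K L Ks Ls ZL ZK.
have trT k (X : 'M[R]_k) : \tr X = \tr X^T by rewrite mxtrace_tr.
have KbT (X Y W : 'M[R]_(n, m)) :
    \tr (K *m X *m L *m Y^T *m K *m W *m Z^T) = \tr (K *m Z *m W^T *m K *m Y *m L *m X^T).
  rewrite [RHS]trT !trmx_mul !trmxK Ks Ls.
  by have := mxtrace_mulC (K) (X *m L *m Y^T *m K *m W *m Z^T); rewrite !mulmxA.
have e1 X Y W : \tr (K *m X *m L *m Z^T *m Y *m L *m W^T) = \tr (K *m X *m Z^T *m K *m Y *m L *m W^T).
  by rewrite -(mulmxA (K *m X) L) -ZK mulmxA.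
have e2 X Y W : \tr (K *m X *m L *m Y^T *m Z *m L *m W^T) = \tr (K *m Z *m W^T *m K *m X *m L *m Y^T).
  rewrite -(mulmxA _ Z) ZL mulmxA.
  by have := mxtrace_mulC (K *m X *m L *m Y^T) (K *m Z *m W^T); rewrite !mulmxA.
have e3 X Y W : \tr (K *m X *m Z^T *m K *m Y *m L *m W^T) = \tr (K *m Z *m X^T *m K *m W *m L *m Y^T).
  apply: etrans _ (KbT Y W X).
  by have := mxtrace_mulC (K *m X *m Z^T) (K *m Y *m L *m W^T); rewrite !mulmxA.
have trN (X : 'M[R]_n) : \tr (- X) = - \tr X by rewrite linearN.
rewrite !(mulmxDr, mulmxDl, mulNmx, mulmxN, trN, mxtraceD, mulmxA).
rewrite (e1 A B C) (e1 B A C) (e1 A C B) (e2 B A C) (e2 A B C) (e2 A C B).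
rewrite (e3 A C B) (e3 C A B); lra.
Qed.

Lemma is_derive_graph_form (z c : 'rV[R]_(n * m)) (A B : 'M[R]_(n, m)) :
  is_derive z c (fun y => graph_form (vec_mx y) A B) (graph_form_derive (vec_mx z) (vec_mx c) A B).
Proof.
have dK n' m' (f : 'rV[R]_(n * m) -> 'M[R]_(n', m')) df : differentiable f z -> is_derive z c f df ->
    is_derive z c (fun y => gram_inv (f y))
      (- (gram_inv (f z) *m (df *m (f z)^T + f z *m df^T) *m gram_inv (f z))).
  move=> fd hf; apply: (@is_derive_invmx _ _ _ (fun y => 1%:M + f y *m (f y)^T)).
  - apply: (@differentiableD _ _ _ (cst _)); first exact: differentiable_cst.
    by apply: differentiable_mulmx => //; exact: differentiable_trmx.
  - exact: gram_graph_unit.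
  - have := is_deriveD (is_derive_cst (1%:M : 'M[R]_n') z c) (is_derive_mulmx hf (is_derive_trmx hf)).
    by rewrite add0r.
have hz := is_derive_vec_mx z c; have zd := @differentiable_vec_mx R n m z.
have hK := dK _ _ _ _ zd hz.
have hL := dK _ _ _ _ (differentiable_trmx zd) (is_derive_trmx hz).
have hA := is_derive_cst (A : 'M[R]_(n, m)) z c.
have hB := is_derive_cst (B^T : 'M[R]_(m, n)) z c.
have := is_derive_mxtrace (is_derive_mulmx (is_derive_mulmx (is_derive_mulmx hK hA) hL) hB).
move=> /is_derive_eq; apply; rewrite /graph_form_derive !trmxK.
have trN (X : 'M[R]_n) : \tr (- X) = - \tr X by rewrite linearN.
rewrite !mulmx0 !addr0 mulmxDl mxtraceD !mulNmx trN; congr (_ + _).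
by rewrite mulmxN mulNmx trN !mulmxA.
Qed.

Lemma grass_metric_entry (z : 'rV[R]_(n * m)) j l :
  grass_metric R n m Q z j l =
  graph_form (vec_mx z) (vec_mx (delta_mx 0 j)) (vec_mx (delta_mx 0 l)).
Proof.
have := grass_metricE z (delta_mx 0 j) (delta_mx 0 l).
rewrite /graph_form => /matrixP/(_ 0 0); rewrite [RHS]mxE mulr1n => <-.
by rewrite -rowE trmx_delta -colE !mxE.
Qed.

Lemma grass_christoffel (z : 'rV[R]_(n * m)) k i j :
  christoffel (grass_metric R n m Q) z k i j =
  mxvec (graph_christoffel (vec_mx z) (vec_mx (delta_mx 0 i)) (vec_mx (delta_mx 0 j))) 0 k.
Proof.
apply: christoffel_unique.
- exact: grass_metric_unit.
- exact: grass_metric_sym.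
move=> l; set G := graph_christoffel _ _ _.
have -> : (mxvec G *m grass_metric R n m Q z) 0 l =
    graph_form (vec_mx z) G (vec_mx (delta_mx 0 l)).
  have := grass_metricE z (mxvec G) (delta_mx 0 l).
  rewrite /graph_form => /matrixP/(_ 0 0); rewrite [RHS]mxE mulr1n mxvecK => <-.
  by rewrite trmx_delta -colE !mxE.
have dE a b c : pderiv c (fun y => grass_metric R n m Q y a b) z =
    graph_form_derive (vec_mx z) (vec_mx (delta_mx 0 c)) (vec_mx (delta_mx 0 a)) (vec_mx (delta_mx 0 b)).
  rewrite /pderiv (_ : (fun _ => _) = fun y => graph_form (vec_mx y)
    (vec_mx (delta_mx 0 a)) (vec_mx (delta_mx 0 b))).
    by have [] := is_derive_graph_form z (delta_mx 0 c) (vec_mx (delta_mx 0 a)) (vec_mx (delta_mx 0 b)).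
  by apply/funext => y; exact: grass_metric_entry.
by rewrite !dE graph_Koszul.
Qed.

Lemma grass_christoffel_sum (z p q : 'rV[R]_(n * m)) k :
  \sum_a \sum_b christoffel (grass_metric R n m Q) z k a b * p 0 a * q 0 b =
  mxvec (graph_christoffel (vec_mx z) (vec_mx p) (vec_mx q)) 0 k.
Proof.
have vE (v : 'rV[R]_(n * m)) : vec_mx v = \sum_a v 0 a *: vec_mx (delta_mx 0 a) :> 'M[R]_(n, m).
  by rewrite {1}[v]row_sum_delta linear_sum /=; apply: eq_bigr => a _; rewrite linearZ.
have E : graph_christoffel (vec_mx z) (vec_mx p) (vec_mx q) = \sum_a \sum_b (p 0 a * q 0 b) *:
    graph_christoffel (vec_mx z) (vec_mx (delta_mx 0 a)) (vec_mx (delta_mx 0 b)).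
  rewrite /graph_christoffel {1 2}(vE p) (vE q).
  have split2 (F G : 'I_(n * m) -> 'I_(n * m) -> 'M[R]_(n, m)) :
     \sum_a \sum_b (p 0 a * q 0 b) *: - (F a b + G a b) =
     - (\sum_a \sum_b (p 0 a * q 0 b) *: F a b + \sum_a \sum_b (p 0 a * q 0 b) *: G a b).
    rewrite -big_split -sumrN; apply: eq_bigr => a _ /=.
    by rewrite -big_split -sumrN; apply: eq_bigr => b _ /=; rewrite scalerN scalerDr.
  rewrite split2; congr (- (_ + _)).
    rewrite !mulmx_suml; apply: eq_bigr => a _.
    rewrite mulmx_sumr; apply: eq_bigr => b _.
    by rewrite -!scalemxAl -scalemxAr scalerA.
  rewrite [RHS]exchange_big /= !mulmx_suml; apply: eq_bigr => b _.
  rewrite mulmx_sumr; apply: eq_bigr => a _.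
  by rewrite -!scalemxAl -scalemxAr scalerA mulrC.
rewrite E linear_sum summxE; apply: eq_bigr => a _.
rewrite linear_sum summxE; apply: eq_bigr => b _.
by rewrite linearZ /= [RHS]mxE grass_christoffel -mulrA mulrC.
Qed.

End GrassMetric.

(** * Derivatives of the Gauss map *)

Section JacobianCalculus.
Variables (R : realType) (n N : nat).
Implicit Types (G : 'rV[R]_n -> 'rV[R]_N) (U : set 'rV[R]_n).

Lemma jacobian_entry G y k l : differentiable G y ->
  jacobian G y k l = 'D_(delta_mx 0 k) G y 0 l.
Proof. by move=> Gd; rewrite deriveEjacobian // -rowE [RHS]mxE. Qed.

Lemma jacobian_row G y k : differentiable G y ->
  row k (jacobian G y) = 'D_(delta_mx 0 k) G y.
Proof. by move=> Gd; rewrite deriveEjacobian // -rowE. Qed.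

Lemma near_jacobian_entry U G x k l : open U -> smooth_on U G -> U x ->
  \forall y \near x, 'D_(delta_mx 0 k) G y 0 l = jacobian G y k l.
Proof.
move=> Uo Gs Ux; have : \forall y \near x, U y by exact: open_nbhs_nbhs.
apply: filterS => y Uy; apply: esym; apply: jacobian_entry.
exact: smooth_on_differentiable Uy.
Qed.

Lemma differentiable_jacobian U G x : open U -> smooth_on U G -> U x ->
  differentiable (jacobian G) x.
Proof.
move=> Uo Gs Ux; apply: differentiable_mx => k l.
apply: near_eq_differentiable (near_jacobian_entry k l Uo Gs Ux) _.
apply: differentiable_entry; exact: smooth_on_differentiable (smooth_on_derive _ Gs) Ux.
Qed.

(** By Schwarz the derivative of a Jacobian is again a Jacobian, so all higher derivatives of the
    parametrization can be handled as matrices of the shape of [J]. *)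
Lemma is_derive_jacobian U G x v : open U -> smooth_on U G -> U x ->
  is_derive x v (jacobian G) (jacobian ('D_v G) x).
Proof.
move=> Uo Gs Ux; apply: is_derive_mx => k l.
apply: near_eq_is_derive (near_jacobian_entry k l Uo Gs Ux) _.
have -> : jacobian ('D_v G) x k l = 'D_v ('D_(delta_mx 0 k) G) x 0 l.
  rewrite jacobian_entry; last exact: smooth_on_differentiable (smooth_on_derive v Gs) Ux.
  by rewrite (Schwarz_smooth _ _ Uo Gs Ux).
apply: is_derive_entry; apply: derivableP; apply: diff_derivable.
exact: smooth_on_differentiable (smooth_on_derive _ Gs) Ux.
Qed.

End JacobianCalculus.

Lemma invmx_mulmx (R : comUnitRingType) n (A B : 'M[R]_n) : A \in unitmx -> B \in unitmx ->
  invmx (A *m B) = invmx B *m invmx A.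
Proof.
move=> Au Bu; have ABu : A *m B \in unitmx by rewrite unitmx_mul Au.
apply: (can_inj (mulKmx ABu)); rewrite mulmxV // mulmxA -(mulmxA A) mulmxV //.
by rewrite mulmx1 mulmxV.
Qed.

(** * Slope coordinates and the normal frame of a graph *)

Section FrameAlgebra.
Variables (R : realType) (n m : nat).
Variable Q : {Q : 'M[R]_(m + n) | Q *m Q^T = 1%:M}.
Let nu := usubmx (sval Q).
Let e := dsubmx (sval Q).
Implicit Types (J : 'M[R]_(n, m + n)) (Z : 'M[R]_(n, m)).

(* The row span of [J] is the graph of [slope J] over the row span of [e]. *)
Definition slope J : 'M[R]_(n, m) := invmx (J *m e^T) *m (J *m nu^T).

(* The columns of [graph_normal Z] span the orthogonal complement of the
   graph of [Z]. *)
Definition graph_normal Z : 'M[R]_(m + n, m) := nu^T - e^T *m Z.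

Lemma frame_decomp k (v : 'M[R]_(k, m + n)) : v = v *m nu^T *m nu + v *m e^T *m e.
Proof.
have QQ : (sval Q)^T *m sval Q = 1%:M by apply: mulmx1C; exact: svalP Q.
rewrite -{1}[v]mulmx1 -QQ -{1 2}(vsubmxK (sval Q)) tr_col_mx mul_row_col.
by rewrite mulmxDr !mulmxA.
Qed.

Lemma slopeE J : J *m e^T \in unitmx ->
  J = (J *m e^T) *m (e + slope J *m nu).
Proof.
by move=> Ju; rewrite mulmxDr !mulmxA mulmxV // mul1mx addrC -frame_decomp.
Qed.

Lemma graph_mul_normal Z : (e + Z *m nu) *m graph_normal Z = 0.
Proof.
have [nn ne en ee] := frame_gram Q.
have eZn : (e + Z *m nu) *m nu^T = Z.
  by rewrite mulmxDl [e *m _]en add0r -mulmxA [nu *m _]nn mulmx1.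
have eZe : (e + Z *m nu) *m e^T = 1%:M.
  by rewrite mulmxDl [e *m _]ee -mulmxA [nu *m _]ne mulmx0 addr0.
by rewrite /graph_normal mulmxBr eZn mulmxA eZe mul1mx subrr.
Qed.

Lemma mul_normal_slope J : J *m e^T \in unitmx -> J *m graph_normal (slope J) = 0.
Proof. by move=> Ju; rewrite {1}[J]slopeE // -mulmxA graph_mul_normal mulmx0. Qed.

(** In frame coordinates the hypotheses read a = - b Z^T and b = a Z, whence b (1 + Z^T Z) = 0. *)
Lemma frame_separate k (v : 'M[R]_(k, m + n)) Z :
  v *m (e + Z *m nu)^T = 0 -> v *m graph_normal Z = 0 -> v = 0.
Proof.
rewrite /graph_normal linearD /= trmx_mul mulmxDr mulmxBr !mulmxA.
set a := v *m e^T; set b := v *m nu^T => /eqP; rewrite addr_eq0 => /eqP aE /eqP.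
rewrite subr_eq0 => /eqP bE.
have b0 : b = 0.
  have := gram_graph_unit Z^T; rewrite trmxK => Zu.
  apply: (can_inj (mulmxK Zu)); rewrite mul0mx mulmxDr mulmx1 mulmxA.
  by rewrite {1}bE aE mulNmx addNr.
by rewrite [v]frame_decomp -/a -/b b0 aE b0 !mul0mx oppr0 mul0mx addr0.
Qed.

(** Both sides equal [E^T *m gram_inv Z] for the graph basis [E]: the right one because
    [J = a *m E], the left one because multiplying it by [1 + Z Z^T] cancels the terms e^T Z Z^T. *)
Lemma graph_gram_inv J : J *m e^T \in unitmx ->
  (e^T + graph_normal (slope J) *m (slope J)^T *m gram_inv (slope J)) =
  J^T *m invmx (J *m J^T) *m (J *m e^T).
Proof.
move=> Ju; set Z := slope J; set a := J *m e^T; set E := e + Z *m nu.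
have JE : J = a *m E by exact: slopeE.
have Gu : 1%:M + Z *m Z^T \in unitmx by exact: gram_graph_unit.
have EE : E *m E^T = 1%:M + Z *m Z^T by exact: graph_gram.
have aTu : a^T \in unitmx by rewrite unitmx_tr.
have -> : invmx (J *m J^T) = invmx a^T *m gram_inv Z *m invmx a.
  have JJ : J *m J^T = a *m (1%:M + Z *m Z^T) *m a^T.
    by rewrite JE trmx_mul -EE !mulmxA.
  by rewrite JJ !invmx_mulmx ?unitmx_mul ?Ju //= mulmxA.
have cancel (c : 'M[R]_n) (X : 'M[R]_(m + n, n)) K : c \in unitmx ->
    (X *m c^T) *m (invmx c^T *m K *m invmx c) *m c = X *m K.
  move=> cu; rewrite -!mulmxA mulVmx // mulmx1 (mulmxA c^T) mulmxV ?mul1mx //.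
  by rewrite unitmx_tr.
have -> : J^T = E^T *m a^T by rewrite {1}JE trmx_mul.
rewrite (cancel a) //; apply: (can_inj (mulmxK Gu)); rewrite mulmxDl.
rewrite /gram_inv mulmxKV // mulmxKV //.
have -> : E^T = e^T + nu^T *m Z^T by rewrite /E raddfD /= trmx_mul.
by rewrite /graph_normal mulmxBl mulmxDr mulmx1 mulmxA [_ - _]addrC addrA addrK.
Qed.

(* The left-hand side is the second covariant derivative of the Gauss map in the
   chart: the terms of the connection that involve Z turn the frame e into the
   orthogonal projection to the tangent space. *)
Lemma graph_second_derivative J Ji Jj Jij :
  J *m e^T \in unitmx ->
  let Z := slope J in
  let P A := invmx (J *m e^T) *m A *m graph_normal Z in
  let C A := A *m J^T *m invmx (J *m J^T) in
  P Jij - invmx (J *m e^T) *m (Ji *m e^T *m P Jj + Jj *m e^T *m P Ji)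
    + graph_christoffel Z (P Ji) (P Jj) =
  P (Jij - C Ji *m Jj - C Jj *m Ji).
Proof.
move=> Ju Z P C.
(* Each first-order product pairs with one half of the Christoffel term; their common factor is the
   left-hand side of [graph_gram_inv]. *)
have PE A B : invmx (J *m e^T) *m (A *m e^T *m P B) + P A *m Z^T *m gram_inv Z *m P B =
    P (C A *m B).
  transitivity (invmx (J *m e^T) *m A *m (e^T + graph_normal Z *m Z^T *m gram_inv Z) *m P B).
    by rewrite mulmxDr mulmxDl !mulmxA.
  rewrite graph_gram_inv // /P /C !mulmxA -(mulmxA _ J) -(mulmxA _ (J *m e^T)).
  by rewrite mulmxV // mulmx1.
have PB A B : P (A - B) = P A - P B by rewrite /P (mulmxBr _ A B) mulmxBl.
rewrite !PB -!PE /graph_christoffel mulmxDr !opprD !addrA.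
by congr (_ - _); rewrite [LHS]addrAC.
Qed.

End FrameAlgebra.

Section MxvecCalculus.
Variables (R : realType) (V : normedModType R) (n m : nat).

Lemma differentiable_mxvec (f : V -> 'M[R]_(n, m)) x :
  differentiable f x -> differentiable (fun y => mxvec (f y)) x.
Proof.
move=> fd; apply: differentiable_mx => i c; rewrite ord1.
case/mxvec_indexP: c => k l.
rewrite (_ : (fun _ => _) = fun y => f y k l); first exact: differentiable_entry.
by apply/funext => y; rewrite mxvecE.
Qed.

Lemma is_derive_mxvec (f : V -> 'M[R]_(n, m)) x v (df : 'M[R]_(n, m)) :
  is_derive x v f df -> is_derive x v (fun y => mxvec (f y)) (mxvec df).
Proof.
move=> fd; apply: is_derive_mx => i c; rewrite ord1.
case/mxvec_indexP: c => k l; rewrite mxvecE.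
rewrite (_ : (fun _ => _) = fun y => f y k l); first exact: is_derive_entry.
by apply/funext => y; rewrite mxvecE.
Qed.

End MxvecCalculus.

(** The Gauss formula: the symbols of an induced metric are the tangential coefficients of the
    second derivatives. By symmetry of [D], the three terms of the Koszul formula reduce to twice
    [T i j l]. *)
Lemma christoffel_symmetric (R : realType) n N (g : 'rV[R]_n -> 'M[R]_n) x
    (J : 'M[R]_(n, N)) (D : 'I_n -> 'M[R]_(n, N)) k i j :
  row_free J -> g x = J *m J^T -> (forall a b l, D a b l = D b a l) ->
  (forall a b c, pderiv a (fun y => g y b c) x = (D a *m J^T + J *m (D a)^T) b c) ->
  christoffel g x k i j = (D i *m J^T *m invmx (J *m J^T)) j k.
Proof.
move=> Jf gJ Dsym gD; have gu := gram_unit Jf.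
pose T a b c := (D a *m J^T) b c.
have Tsym a b c : T a b c = T b a c.
  by rewrite /T mxE [RHS]mxE; apply: eq_bigr => l _; rewrite Dsym.
have gE a b c : pderiv a (fun y => g y b c) x = T a b c + T a c b.
  rewrite gD mxE /T; congr (_ + _); rewrite mxE [RHS]mxE.
  by apply: eq_bigr => l _; rewrite [in LHS]mxE [in RHS]mxE mulrC.
have -> : (D i *m J^T *m invmx (J *m J^T)) j k =
   (row j (D i *m J^T) *m invmx (J *m J^T)) 0 k by rewrite -row_mul [RHS]mxE.
apply: christoffel_unique; rewrite gJ //; first by rewrite trmx_mul trmxK.
move=> l; rewrite mulmxKV // mxE -/(T i j l) !gE.
rewrite (Tsym i l) (Tsym j i) (Tsym l j i); lra.
Qed.

(** * Derivatives of the Gauss map in slope coordinates *)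

Section LocalGauss.
Variables (R : realType) (n m : nat).
Variable Q : {Q : 'M[R]_(m + n) | Q *m Q^T = 1%:M}.
Let nu := usubmx (sval Q).
Let e := dsubmx (sval Q).
Variables (F : 'rV[R]_n -> 'rV[R]_(m + n)) (U : set 'rV[R]_n).
Hypotheses (Uo : open U) (Fs : smooth_on U F).

Let J y := jacobian F y.
Let Z y := slope Q (J y).
Let P v y := invmx (J y *m e^T) *m jacobian ('D_v F) y *m graph_normal Q (Z y).

Lemma differentiable_frame_coord k (B : 'M[R]_(m + n, k)) y : U y ->
  differentiable (fun z => J z *m B) y.
Proof.
move=> Uy; apply: differentiable_mulmx; last exact: differentiable_cst.
exact: differentiable_jacobian Uo Fs Uy.
Qed.

Lemma is_derive_frame_coord G k (B : 'M[R]_(m + n, k)) y v : smooth_on U G -> U y ->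
  is_derive y v (fun z => jacobian G z *m B) (jacobian ('D_v G) y *m B).
Proof.
by move=> Gs Uy; apply: is_derive_mulmxr; exact: is_derive_jacobian Uo Gs Uy.
Qed.

Lemma differentiable_slope y : U y -> J y *m e^T \in unitmx -> differentiable Z y.
Proof.
move=> Uy yu; apply: differentiable_mulmx; last exact: differentiable_frame_coord.
by apply: differentiable_invmx => //; exact: differentiable_frame_coord.
Qed.

Lemma is_derive_slope y v : U y -> J y *m e^T \in unitmx -> is_derive y v Z (P v y).
Proof.
move=> Uy yu.
have ha := is_derive_invmx (differentiable_frame_coord e^T Uy) yu (is_derive_frame_coord e^T v Fs Uy).
have := is_derive_mulmx ha (is_derive_frame_coord nu^T v Fs Uy).
move=> /is_derive_eq; apply.
have alg (c : 'M[R]_n) (A : 'M[R]_(n, m + n)) (B : 'M[R]_(n, m)) :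
    - (c *m (A *m e^T) *m c) *m B + c *m (A *m nu^T) = c *m A *m (nu^T - e^T *m (c *m B)).
  by rewrite mulmxBr !mulmxA mulNmx addrC.
exact: alg.
Qed.

Lemma is_derive_slope_derive y v w : U y -> J y *m e^T \in unitmx ->
  is_derive y v (P w) (invmx (J y *m e^T) *m jacobian ('D_v ('D_w F)) y *m graph_normal Q (Z y)
   - invmx (J y *m e^T) *m (jacobian ('D_v F) y *m e^T *m P w y + jacobian ('D_w F) y *m e^T *m P v y)).
Proof.
move=> Uy yu.
have ha := is_derive_invmx (differentiable_frame_coord e^T Uy) yu (is_derive_frame_coord e^T v Fs Uy).
have hn : is_derive y v (fun z => graph_normal Q (Z z)) (- (e^T *m P v y)).
  have := is_deriveB (is_derive_cst (nu^T : 'M[R]_(m + n, m)) y v)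
    (is_derive_mulmxl e^T (is_derive_slope v Uy yu)).
  by rewrite sub0r.
have := is_derive_mulmx (is_derive_mulmx ha (is_derive_jacobian v Uo (smooth_on_derive w Fs) Uy)) hn.
move=> /is_derive_eq; apply.
have alg (c : 'M[R]_n) (A A' A'' : 'M[R]_(n, m + n)) (g : 'M[R]_(m + n, m)) (p : 'M[R]_(n, m)) :
    (- (c *m (A *m e^T) *m c) *m A' + c *m A'') *m g + c *m A' *m (- (e^T *m p)) =
    c *m A'' *m g - c *m (A *m e^T *m (c *m A' *m g) + A' *m e^T *m p).
  rewrite mulmxN !mulmxDl mulNmx mulmxDr opprD addrA.
  by rewrite [X in X - _]addrC !mulmxA !mulNmx.
exact: alg.
Qed.

Lemma near_slope_unit x : U x -> J x *m e^T \in unitmx ->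
  \forall y \near x, U y /\ J y *m e^T \in unitmx.
Proof.
move=> Ux xu; apply: filterI; first exact: open_nbhs_nbhs.
exact: near_unitmx (differentiable_frame_coord e^T Ux) xu.
Qed.

(** Stated on a neighbourhood because the connection differentiates [jacobian u] once more;
    [near_join] supplies the agreement of [u] with the slope around each nearby point. *)
Lemma near_jacobian_slope (u : 'rV[R]_n -> 'rV[R]_(n * m)) x :
  U x -> J x *m e^T \in unitmx -> (\forall y \near x, u y = mxvec (Z y)) ->
  \forall y \near x, forall j c, jacobian u y j c = mxvec (P (delta_mx 0 j) y) 0 c.
Proof.
move=> Ux xu /near_join uZ; apply: filterS2 uZ (near_slope_unit Ux xu) => y uZ [Uy yu] j c.
have Zu : \forall z \near y, mxvec (Z z) = u z by apply: filterS uZ => z ->.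
rewrite jacobian_entry.
  have /(near_eq_is_derive Zu)[_ ->] := is_derive_mxvec (is_derive_slope (delta_mx 0 j) Uy yu).
  by [].
apply: near_eq_differentiable Zu _.
by apply: differentiable_mxvec; exact: differentiable_slope.
Qed.

Lemma jacobian_derive_sym x i j l : U x ->
  jacobian ('D_(delta_mx 0 i) F) x j l = jacobian ('D_(delta_mx 0 j) F) x i l.
Proof.
move=> Ux.
have E a b : jacobian ('D_(delta_mx 0 a) F) x b l = 'D_(delta_mx 0 b) ('D_(delta_mx 0 a) F) x 0 l.
  by apply: jacobian_entry; exact: smooth_on_differentiable (smooth_on_derive _ Fs) Ux.
apply: etrans (E i j) _; apply: etrans _ (esym (E j i)).
exact: (congr1 (fun v : 'rV[R]_(m + n) => v 0 l) (Schwarz_smooth _ _ Uo Fs Ux)).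
Qed.

Lemma is_derive_gram x v : U x ->
  is_derive x v (fun y => J y *m (J y)^T)
    (jacobian ('D_v F) x *m (J x)^T + J x *m (jacobian ('D_v F) x)^T).
Proof.
move=> Ux; have h := is_derive_jacobian v Uo Fs Ux.
exact: is_derive_mulmx h (is_derive_trmx h).
Qed.

Lemma gram_christoffel x k i j : U x -> row_free (J x) ->
  christoffel (fun y => J y *m (J y)^T) x k i j =
  (jacobian ('D_(delta_mx 0 i) F) x *m (J x)^T *m invmx (J x *m (J x)^T)) j k.
Proof.
move=> Ux Jf.
apply: (@christoffel_symmetric _ _ _ _ x (J x) (fun a => jacobian ('D_(delta_mx 0 a) F) x)).
- exact: Jf.
- exact: erefl.
- by move=> a b l; exact: jacobian_derive_sym.
- move=> a b c; have [_ dE] := is_derive_entry b c (is_derive_gram (delta_mx 0 a) Ux).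
  exact: dE.
Qed.

End LocalGauss.

Lemma is_derive_expR_comp (R : realType) (V : normedModType R) (q : V -> R) x v dq :
  differentiable q x -> is_derive x v q dq ->
  is_derive x v (fun y => expR (q y)) (expR (q x) * dq).
Proof.
move=> qd [qv dqE].
have ed : differentiable (@expR R) (q x) by exact/derivable1_diffP/derivable_expR.
apply: DeriveDef.
  exact/diff_derivable/(differentiable_comp qd ed).
rewrite deriveE; last exact: differentiable_comp qd ed.
have eD : derive1 (@expR R) (q x) = expR (q x).
  by rewrite derive1E; have [] := is_derive_expR (q x).
rewrite (diff_comp qd ed) /= diff1E // eD -deriveE // dqE.
by rewrite /GRing.scale /= mulrC.
Qed.

(** * The weighted tension in a Grassmannian chart *)

Section Tension.
Variables (R : realType) (n m : nat).
Variable Q : {Q : 'M[R]_(m + n) | Q *m Q^T = 1%:M}.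

(** The derivative of the weight is given as [w x * l] so that [w x] factors out of every term; the
    logarithmic derivative [l] becomes the drift coefficient. *)
Lemma grass_natural_connection (g : 'rV[R]_n -> 'M[R]_n) (w : 'rV[R]_n -> R)
    (u : 'rV[R]_n -> 'rV[R]_(n * m)) (P : 'I_n -> 'rV[R]_n -> 'M[R]_(n, m))
    (DP : 'M[R]_(n, m)) (l : R) x i j :
  (\forall y \near x, forall j c, jacobian u y j c = mxvec (P j y) 0 c) ->
  is_derive x (delta_mx 0 i) (P j) DP ->
  is_derive x (delta_mx 0 i) w (w x * l) ->
  natural_connection g (grass_metric R n m Q) u (fun y => w y *: jacobian u y) x i j =
  w x *: mxvec (DP + graph_christoffel (vec_mx (u x)) (P i x) (P j x) + l *: P j x
                - \sum_k christoffel g x k i j *: P k x).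
Proof.
move=> uP hP hw; apply/rowP => c; rewrite [LHS]mxE [RHS]mxE.
have uPx := nbhs_singleton uP.
have scaleE k1 k2 (r : R) (A : 'M[R]_(k1, k2)) a b : (r *: A) a b = r * A a b by rewrite mxE.
have -> : pderiv i (fun y => (w y *: jacobian u y) j c) x =
    w x * mxvec DP 0 c + mxvec (P j x) 0 c * (w x * l).
  have h := is_deriveM hw (is_derive_entry 0 c (is_derive_mxvec hP)).
  have E : \forall y \near x, (w * (fun y => mxvec (P j y) 0 c)) y = (w y *: jacobian u y) j c.
    by apply: filterS uP => y uPy; rewrite [RHS]mxE uPy.
  by have [_] := near_eq_is_derive E h; apply.
have -> : \sum_a \sum_b christoffel (grass_metric R n m Q) (u x) c a b *
      jacobian u x i a * (w x *: jacobian u x) j b =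
    w x * mxvec (graph_christoffel (vec_mx (u x)) (P i x) (P j x)) 0 c.
  rewrite -[P i x in RHS]mxvecK -[P j x in RHS]mxvecK -(grass_christoffel_sum Q).
  rewrite big_distrr /=; apply: eq_bigr => a _; rewrite big_distrr /=.
  by apply: eq_bigr => b _; rewrite scaleE !uPx mulrCA.
have -> : \sum_k christoffel g x k i j * (w x *: jacobian u x) k c =
    w x * mxvec (\sum_k christoffel g x k i j *: P k x) 0 c.
  rewrite linear_sum summxE big_distrr /=; apply: eq_bigr => k _.
  by rewrite scaleE uPx linearZ scaleE mulrCA.
have addE (A B : 'rV[R]_(n * m)) : (A + B) 0 c = A 0 c + B 0 c by rewrite mxE.
have oppE (A : 'rV[R]_(n * m)) : (- A) 0 c = - A 0 c by rewrite mxE.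
have vD (A B : 'M[R]_(n, m)) : mxvec (A + B) = mxvec A + mxvec B by rewrite linearD.
have vN (A : 'M[R]_(n, m)) : mxvec (- A) = - mxvec A by rewrite linearN.
have vZ (r : R) (A : 'M[R]_(n, m)) : mxvec (r *: A) = r *: mxvec A by rewrite linearZ.
rewrite !(vD, vN, vZ) !(addE, oppE, scaleE); ring.
Qed.

End Tension.

Section TensionAlgebra.
Variables (R : realType) (n N m : nat).
Variables (M : 'M[R]_n) (J : 'M[R]_(n, N)) (D : 'I_n -> 'M[R]_(n, N))
  (DD : 'I_n -> 'I_n -> 'M[R]_(n, N)) (V : 'M[R]_(N, m)) (f : 'rV[R]_N).
Hypotheses (Msym : M^T = M) (Dsym : forall a b l, D a b l = D b a l).
Let C a := D a *m J^T *m M.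
Let T a b := row a (D b) *m V.

Let Drow a b : row a (D b) = row b (D a).
Proof. by apply/rowP => l; rewrite !mxE Dsym. Qed.

Let Tsym a b : T a b = T b a. Proof. by rewrite /T Drow. Qed.

Let Csym a b l : C a b l = C b a l.
Proof.
have -> : C a b l = (row b (D a) *m J^T *m M) 0 l by rewrite -!row_mul [RHS]mxE.
by rewrite Drow -!row_mul mxE.
Qed.

Let rowC a b c : row a (C b *m D c *m V) = \sum_l C b a l *: T l c.
Proof.
rewrite -mulmxA row_mul mulmx_sum_row; apply: eq_bigr => l _.
by rewrite mxE row_mul.
Qed.

Let Mswap i j : M i j = M j i. Proof. by rewrite -[in LHS]Msym mxE. Qed.

(* M is the inverse metric, D a and DD a b are the derivatives of J, V spans the
   normal space and f is the position vector: the left-hand side is the tension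
   field and the right-hand side the derivative of H + X^N / 2.  Both are
   S1 - 2 X - S3 - S2 below, up to the Codazzi symmetries [Dsym]. *)
Lemma tension_shrinker_algebra k :
  \sum_i \sum_j M i j *: row k ((DD i j - C i *m D j - C j *m D i) *m V
     + (- (f *m (row i J)^T) 0 0 / 2) *: (D j *m V) - \sum_l C i j l *: (D l *m V)) =
  \sum_i \sum_j ((- (M *m (D k *m J^T + J *m (D k)^T) *m M)) i j *: (row i (D j) *m V)
     + M i j *: ((row k (DD i j) - row i (D j) *m J^T *m M *m D k) *m V))
  - 2^-1 *: (f *m J^T *m M *m D k *m V).
Proof.
pose X := \sum_i \sum_j \sum_l (M i j * C k j l) *: T l i.
pose S1 := \sum_i \sum_j M i j *: (row k (DD i j) *m V).
pose S2 := \sum_i \sum_j M i j *: (\sum_l C i j l *: T k l).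
pose S3 := 2^-1 *: (f *m J^T *m M *m D k *m V).
have qE i : (f *m J^T) 0 i = (f *m (row i J)^T) 0 0.
  by rewrite tr_row colE mulmxA -colE [RHS]mxE.
have S3E : S3 = \sum_i \sum_j M i j *: (((f *m (row i J)^T) 0 0 / 2) *: T k j).
  rewrite /S3 -(mulmxA (_ *m M)) mulmx_sum_row scaler_sumr exchange_big /=.
  apply: eq_bigr => j _; rewrite mxE scaler_suml scaler_sumr.
  apply: eq_bigr => i _; rewrite row_mul -/(T j k) Tsym !scalerA qE; congr (_ *: _).
  ring.
(* [X] occurs twice on each side: as the tangential corrections of the second covariant derivative
   ([XE1], [XE2]), and as the two halves of the derivative of the inverse metric ([XE3], [XE4]). *)
have XE1 : X = \sum_i \sum_j M i j *: row k (C j *m D i *m V).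
  apply: eq_bigr => i _; apply: eq_bigr => j _; rewrite rowC scaler_sumr.
  by apply: eq_bigr => l _; rewrite scalerA Csym.
have XE2 : X = \sum_i \sum_j M i j *: row k (C i *m D j *m V).
  rewrite XE1 exchange_big /=; apply: eq_bigr => i _; apply: eq_bigr => j _.
  by rewrite Mswap.
have XE3 : X = \sum_i \sum_j (M *m C k) i j *: T i j.
  apply: eq_bigr => i _; rewrite exchange_big /=; apply: eq_bigr => l _.
  by rewrite mxE scaler_suml; apply: eq_bigr => j _; rewrite Tsym.
have XE4 : X = \sum_i \sum_j (M *m C k) j i *: T i j.
  rewrite XE3 exchange_big /=; apply: eq_bigr => i _; apply: eq_bigr => j _.
  by rewrite Tsym.
(* The Christoffel term of M on the left matches the derivative of the normal projection inside H on
   the right. *)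
have S2E : S2 = \sum_i \sum_j M i j *: (row i (D j) *m J^T *m M *m D k *m V).
  apply: eq_bigr => i _; apply: eq_bigr => j _; rewrite -!row_mul -/(C j) rowC.
  by congr (_ *: _); apply: eq_bigr => l _; rewrite Tsym Csym.
have sum2D (G H : 'I_n -> 'I_n -> 'rV[R]_m) :
    \sum_i \sum_j (G i j + H i j) = \sum_i \sum_j G i j + \sum_i \sum_j H i j.
  by rewrite -big_split /=; apply: eq_bigr => i _; rewrite -big_split.
have sum2N (G : 'I_n -> 'I_n -> 'rV[R]_m) :
    \sum_i \sum_j - G i j = - \sum_i \sum_j G i j.
  by rewrite -sumrN; apply: eq_bigr => i _; rewrite -sumrN.
transitivity (S1 - X - X - S3 - S2).
  rewrite {1}XE2 {1}XE1 S3E /S1 /S2 -!sum2N -!sum2D.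
  apply: eq_bigr => i _; apply: eq_bigr => j _; rewrite -!scalerN -!scalerDr; congr (_ *: _).
  have rowD (A B : 'M[R]_(n, m)) : row k (A + B) = row k A + row k B by rewrite linearD.
  have rowN (A : 'M[R]_(n, m)) : row k (- A) = - row k A by rewrite linearN.
  have rowZ r (A : 'M[R]_(n, m)) : row k (r *: A) = r *: row k A by rewrite linearZ.
  have rowS (A : 'I_n -> 'M[R]_(n, m)) : row k (\sum_l A l) = \sum_l row k (A l) by rewrite linear_sum.
  rewrite !mulmxBl !(rowD, rowN) rowZ rowS (row_mul k (DD i j)) (row_mul k (D j)) -/(T k j).
  rewrite mulNr scaleNr scalerN.
  congr (_ - _); apply: eq_bigr => l _.
  by rewrite rowZ row_mul.
rewrite S2E {1}XE3 XE4 -/S3 addrAC; congr (_ - _).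
rewrite /S1 -!sum2N -!sum2D; apply: eq_bigr => i _; apply: eq_bigr => j _.
rewrite mulmxBl scalerBr [RHS]addrC [RHS]addrAC; congr (_ - _).
rewrite -[in LHS]addrA; congr (_ + _).
have -> : M *m (D k *m J^T + J *m (D k)^T) *m M = M *m C k + (M *m C k)^T.
  by rewrite mulmxDr mulmxDl /C !trmx_mul trmxK Msym !mulmxA.
by rewrite [in RHS]mxE [in RHS]mxE [(_^T) _ _]mxE opprD scalerDl !scaleNr -/(T i j).
Qed.

End TensionAlgebra.

(** * Derivative of the shrinker section *)

Section NormalProj.
Variables (R : realType) (V : normedModType R) (n N : nat).

Lemma is_derive_scale k l (c : V -> R) (f : V -> 'M[R]_(k, l)) x v dc df :
  is_derive x v c dc -> is_derive x v f df ->
  is_derive x v (fun y => c y *: f y) (dc *: f x + c x *: df).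
Proof.
move=> hc hf; apply: is_derive_mx => i j.
rewrite (_ : (fun _ => _) = c * (fun y => f y i j)); last first.
  by apply/funext => y; rewrite mxE.
apply: is_derive_eq (is_deriveM hc (is_derive_entry i j hf)) _.
by rewrite !mxE [RHS]addrC (mulrC dc).
Qed.

Lemma differentiable_scale k l (c : V -> R) (f : V -> 'M[R]_(k, l)) x :
  differentiable c x -> differentiable f x -> differentiable (fun y => c y *: f y) x.
Proof.
move=> hc hf; apply: differentiable_mx => i j.
rewrite (_ : (fun _ => _) = c * (fun y => f y i j)); last first.
  by apply/funext => y; rewrite mxE.
by apply: differentiableM => //; exact: differentiable_entry.
Qed.

Variables (J : V -> 'M[R]_(n, N)) (f : V -> 'rV[R]_N) (x : V).
Hypotheses (Jd : differentiable J x) (fd : differentiable f x) (Jf : row_free (J x)).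

Lemma differentiable_gram_inv : differentiable (fun y => invmx (J y *m (J y)^T)) x.
Proof.
apply: (@differentiable_invmx _ _ _ (fun y => J y *m (J y)^T)).
  by apply: differentiable_mulmx => //; exact: differentiable_trmx.
exact: gram_unit.
Qed.

Lemma differentiable_proj_coef :
  differentiable (fun y => f y *m (J y)^T *m invmx (J y *m (J y)^T)) x.
Proof.
apply: differentiable_mulmx; last exact: differentiable_gram_inv.
by apply: differentiable_mulmx => //; exact: differentiable_trmx.
Qed.

Lemma differentiable_normal_proj :
  differentiable (fun y => normal_proj (J y) (f y)) x.
Proof.
apply: (@differentiableB _ _ _ f) => //.
exact: differentiable_mulmx differentiable_proj_coef Jd.
Qed.

(** The coefficient [X] is left unspecified: it multiplies [J x], so it disappears against any
    normal frame. *)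
Lemma is_derive_normal_proj v dJ df : is_derive x v J dJ -> is_derive x v f df ->
  exists X, is_derive x v (fun y => normal_proj (J y) (f y))
    (df - (X *m J x + f x *m (J x)^T *m invmx (J x *m (J x)^T) *m dJ)).
Proof.
move=> hJ hf; exists ('D_v (fun y => f y *m (J y)^T *m invmx (J y *m (J y)^T)) x).
apply: is_deriveB hf (is_derive_mulmx _ hJ).
exact/derivableP/diff_derivable/differentiable_proj_coef.
Qed.

End NormalProj.

Lemma normal_proj_mul (R : realType) n N m (J : 'M[R]_(n, N)) (v : 'rV[R]_N) (B : 'M[R]_(N, m)) :
  J *m B = 0 -> normal_proj J v *m B = v *m B.
Proof. by move=> JB; rewrite /normal_proj mulmxBl -(mulmxA _ J B) JB mulmx0 subr0. Qed.

Section ShrinkerDerivative.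
Variables (R : realType) (n N : nat).
Variables (F : 'rV[R]_n -> 'rV[R]_N) (U : set 'rV[R]_n).
Hypotheses (Uo : open U) (Fs : smooth_on U F).
Let J y := jacobian F y.
Let D k y := jacobian ('D_(delta_mx 0 k) F) y.
Let DD i j y := jacobian ('D_(delta_mx 0 i) ('D_(delta_mx 0 j) F)) y.

Let dJ x : U x -> differentiable J x.
Proof. by move=> Ux; exact: differentiable_jacobian Uo Fs Ux. Qed.

Let dFF i j x : U x -> differentiable ('D_(delta_mx 0 i) ('D_(delta_mx 0 j) F)) x.
Proof. by move=> Ux; exact: smooth_on_differentiable (smooth_on_derive _ (smooth_on_derive _ Fs)) Ux. Qed.

Lemma differentiable_shrinker x : U x -> row_free (J x) ->
  differentiable (shrinker_section F) x.
Proof.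
move=> Ux Jf; apply: (@differentiableD _ _ _ (fun y => \sum_i \sum_j invmx (J y *m (J y)^T) i j *:
     normal_proj (J y) ('D_(delta_mx 0 i) ('D_(delta_mx 0 j) F) y))
   (fun y => 2^-1 *: normal_proj (J y) (F y))).
  apply: differentiable_bigsum => i _; apply: differentiable_bigsum => j _.
  apply: differentiable_scale.
    by apply: differentiable_entry; exact: differentiable_gram_inv (dJ Ux) Jf.
  exact: differentiable_normal_proj (dJ Ux) (dFF i j Ux) Jf.
apply: differentiableZ.
exact: differentiable_normal_proj (dJ Ux) (smooth_on_differentiable Fs Ux) Jf.
Qed.

Lemma shrinker_derive m (B : 'M[R]_(N, m)) x k : U x -> row_free (J x) -> J x *m B = 0 ->
  let M := invmx (J x *m (J x)^T) in
  'D_(delta_mx 0 k) (shrinker_section F) x *m B =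
  \sum_i \sum_j ((- (M *m (D k x *m (J x)^T + J x *m (D k x)^T) *m M)) i j *: (row i (D j x) *m B)
     + M i j *: ((row k (DD i j x) - row i (D j x) *m (J x)^T *m M *m D k x) *m B))
  - 2^-1 *: (F x *m (J x)^T *m M *m D k x *m B).
Proof.
move=> Ux Jf JB M.
set v : 'rV[R]_n := delta_mx 0 k.
have hJ : is_derive x v J (D k x) := is_derive_jacobian v Uo Fs Ux.
have hg : is_derive x v (fun y => J y *m (J y)^T) (D k x *m (J x)^T + J x *m (D k x)^T).
  exact: is_derive_mulmx hJ (is_derive_trmx hJ).
have dg : differentiable (fun y => J y *m (J y)^T) x.
  by apply: differentiable_mulmx (dJ Ux) _; apply: differentiable_trmx; exact: dJ.
have hM := is_derive_invmx dg (gram_unit Jf) hg.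
have hFF i j : is_derive x v ('D_(delta_mx 0 i) ('D_(delta_mx 0 j) F)) (row k (DD i j x)).
  rewrite /DD jacobian_row; last exact: dFF.
  by apply/derivableP/diff_derivable; exact: dFF.
have rowD i j : 'D_(delta_mx 0 i) ('D_(delta_mx 0 j) F) x = row i (D j x).
  apply: esym; apply: jacobian_row.
  exact: smooth_on_differentiable (smooth_on_derive _ Fs) Ux.
have hF : is_derive x v F (row k (J x)).
  rewrite /J jacobian_row; last exact: smooth_on_differentiable Fs Ux.
  by apply/derivableP/diff_derivable; exact: smooth_on_differentiable Fs Ux.
have hN i j := is_derive_normal_proj (dJ Ux) (dFF i j Ux) Jf hJ (hFF i j).
have [XF hNF] := is_derive_normal_proj (dJ Ux) (smooth_on_differentiable Fs Ux) Jf hJ hF.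
pose Xs i j := sval (cid (hN i j)).
(* The unspecified coefficients are chosen for all [i] and [j] at once, so that the derivatives can
   be summed. *)
have hNs i j : is_derive x v _ _ := svalP (cid (hN i j)).
have hS := is_deriveD
  (is_derive_bigsum (index_enum _) (fun i (_ : xpredT i) => is_derive_bigsum (index_enum _) (fun j (_ : xpredT j) =>
     is_derive_scale (is_derive_entry i j hM) (hNs i j))))
  (is_deriveZ 2^-1 hNF).
have [_ ->] := hS.
have killJ (r : 'rV[R]_N) (X : 'rV[R]_n) (Y : 'rV[R]_N) :
    (r - (X *m J x + Y)) *m B = (r - Y) *m B.
  by rewrite !mulmxBl mulmxDl -(mulmxA X) JB mulmx0 add0r.
have scaleB (b c : R) (p q : 'rV[R]_N) :
    (b *: p + c *: q) *m B = b *: (p *m B) + c *: (q *m B).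
  by rewrite mulmxDl -!scalemxAl.
rewrite mulmxDl mulmx_suml; congr (_ + _).
  apply: eq_bigr => i _; rewrite mulmx_suml; apply: eq_bigr => j _.
  apply: etrans (scaleB _ _ _ _) _; rewrite -rowD.
  by congr (_ *: _ + _ *: _); [exact: normal_proj_mul|exact: killJ].
have Z1 (c : R) (r : 'rV[R]_N) (X : 'rV[R]_n) (Y : 'rV[R]_N) : r *m B = 0 ->
    (c *: (r - (X *m J x + Y))) *m B = - (c *: (Y *m B)).
  by move=> rB; rewrite -scalemxAl killJ mulmxBl rB sub0r scalerN.
(* The derivative of the position vector is tangent; X^N contributes only through the derivative of
   its projection. *)
by apply: Z1; rewrite -row_mul JB row0.
Qed.

End ShrinkerDerivative.

Section TensionShrinker.
Variables (R : realType) (n m : nat).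
Variable Q : {Q : 'M[R]_(m + n) | Q *m Q^T = 1%:M}.
Let e := dsubmx (sval Q).
Variables (F : 'rV[R]_n -> 'rV[R]_(m + n)) (U : set 'rV[R]_n).
Hypotheses (Uo : open U) (Fs : smooth_on U F).
Let J y := jacobian F y.
Let Z y := slope Q (J y).
Let w y := expR (- (F y *m (F y)^T) 0 0 / 4).

(** The quarter in the exponent gives the drift -<X, d_i X>/2, whose factor is that of X^N / 2. *)
Lemma is_derive_gauss_weight x i : U x ->
  is_derive x (delta_mx 0 i) w (w x * (- (F x *m (row i (J x))^T) 0 0 / 2)).
Proof.
move=> Ux; have Fd := smooth_on_differentiable Fs Ux.
have hF : is_derive x (delta_mx 0 i) F (row i (J x)).
  by rewrite /J jacobian_row //; exact/derivableP/diff_derivable.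
have hq := is_derive_entry 0 0 (is_derive_mulmx hF (is_derive_trmx hF)).
have qd : differentiable (fun y => (F y *m (F y)^T) 0 0) x.
  by apply/differentiable_entry/differentiable_mulmx => //; exact: differentiable_trmx.
have qd' : differentiable (fun y => - (F y *m (F y)^T) 0 0 / 4) x.
  rewrite (_ : (fun _ => _) = (- 4^-1) *: (fun y => (F y *m (F y)^T) 0 0)).
    exact: differentiableZ.
  by apply/funext => y; rewrite mulNr -mulrN mulrC.
have hq' : is_derive x (delta_mx 0 i) (fun y => - (F y *m (F y)^T) 0 0 / 4)
    (- (F x *m (row i (J x))^T) 0 0 / 2).
  rewrite (_ : (fun _ => _) = (- 4^-1) *: (fun y => (F y *m (F y)^T) 0 0)); last first.
    by apply/funext => y; rewrite mulNr -mulrN mulrC.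
  apply: is_derive_eq (is_deriveZ (- 4^-1) hq) _.
  have sym : (row i (J x) *m (F x)^T) 0 0 = (F x *m (row i (J x))^T) 0 0.
    by rewrite -!trace_mx11 -mxtrace_tr trmx_mul trmxK.
  have addE (A B : 'M[R]_1) : (A + B) 0 0 = A 0 0 + B 0 0 by rewrite mxE.
  rewrite addE sym; set q := (F x *m _) 0 0; rewrite /GRing.scale /=; lra.
exact: is_derive_expR_comp qd' hq'.
Qed.

Lemma tension_shrinker (u : 'rV[R]_n -> 'rV[R]_(n * m)) x k :
  U x -> row_free (J x) -> J x *m e^T \in unitmx ->
  (\forall y \near x, u y = mxvec (Z y)) ->
  row k (J x *m e^T *m vec_mx (weighted_tension (fun y => J y *m (J y)^T)
     (grass_metric R n m Q) w u x)) =
  'D_(delta_mx 0 k) (shrinker_section F) x *m graph_normal Q (Z x).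
Proof.
move=> Ux Jf xu uZ.
have JV : J x *m graph_normal Q (Z x) = 0 by exact: mul_normal_slope.
have hS := @shrinker_derive _ _ _ _ U Uo Fs _ (graph_normal Q (Z x)) x k Ux Jf JV.
cbv zeta in hS; apply: etrans _ (esym hS).
set M := invmx (J x *m (J x)^T).
pose D i := jacobian ('D_(delta_mx 0 i) F) x.
pose DD i j := jacobian ('D_(delta_mx 0 i) ('D_(delta_mx 0 j) F)) x.
have Ms : M^T = M by rewrite /M trmx_inv trmx_mul trmxK.
have Dsym a b l : D a b l = D b a l by exact: (jacobian_derive_sym Uo Fs a b l Ux).
apply: etrans _ (tension_shrinker_algebra (J x) DD (graph_normal Q (Z x)) (F x) Ms Dsym k).
set V := graph_normal Q (Z x).
have w0 : w x != 0 by apply: lt0r_neq0; exact: expR_gt0.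
pose ai := invmx (J x *m e^T).
pose Pf i y := invmx (J y *m e^T) *m jacobian ('D_(delta_mx 0 i) F) y *m graph_normal Q (Z y).
pose Y i j := (DD i j - D i *m (J x)^T *m M *m D j - D j *m (J x)^T *m M *m D i) *m V
      + (- (F x *m (row i (J x))^T) 0 0 / 2) *: (D j *m V)
      - \sum_l (D i *m (J x)^T *m M) j l *: (D l *m V).
(* The factor [ai], inverse of the frame matrix a, comes out of every term on the left; after it is
   cancelled, [Y i j] is the summand of [tension_shrinker_algebra] before row [k] is taken. *)
have conn i j : natural_connection (fun y => J y *m (J y)^T) (grass_metric R n m Q) u
      (fun y => w y *: jacobian u y) x i j = w x *: mxvec (ai *m Y i j).
  have h := @grass_natural_connection R n m Q (fun y => J y *m (J y)^T) w u Pf _ _ x i j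
    (near_jacobian_slope Uo Fs Ux xu uZ)
    (is_derive_slope_derive Uo Fs (delta_mx 0 i) (delta_mx 0 j) Ux xu)
    (is_derive_gauss_weight i Ux).
  have dist (c : 'M[R]_n) (A B E : 'M[R]_(n, m)) : c *m (A + B - E) = c *m A + c *m B - c *m E.
    by rewrite mulmxBr mulmxDr.
  apply: etrans h _; congr (_ *: mxvec _); apply: etrans _ (esym (dist _ _ _ _)).
  have uxE : vec_mx (u x) = Z x by rewrite (nbhs_singleton uZ) mxvecK.
  rewrite uxE; congr (_ + _ - _).
  - have G := @graph_second_derivative R n m Q (J x) (D i) (D j) (DD i j) xu.
    by cbv zeta in G; exact: etrans G (esym (mulmxA _ _ _)).
  - exact: etrans (congr1 _ (esym (mulmxA _ _ _))) (scalemxAr _ _ _).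
  - rewrite mulmx_sumr; apply: eq_bigr => l _; rewrite -scalemxAr mulmxA.
    by congr (_ *: _); exact: (@gram_christoffel _ _ _ _ _ Uo Fs x l i j Ux Jf).
have -> : weighted_tension (fun y => J y *m (J y)^T) (grass_metric R n m Q) w u x =
    mxvec (ai *m \sum_i \sum_j M i j *: Y i j).
  rewrite /weighted_tension /metric_trace scaler_sumr mulmx_sumr linear_sum.
  apply: eq_bigr => i _; rewrite scaler_sumr mulmx_sumr linear_sum.
  apply: eq_bigr => j _; rewrite conn -/M -scalemxAr [in RHS]linearZ /=.
  by rewrite !scalerA; congr (_ *: _); field.
rewrite mxvecK mulmxA mulmxV // mul1mx linear_sum; apply: eq_bigr => i _.
by rewrite linear_sum; apply: eq_bigr => j _; rewrite linearZ.
Qed.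

End TensionShrinker.

(** * Charts and conclusion *)

Section GrassCharts.
Variables (R : realType) (n m : nat).
Variable Q : {Q : 'M[R]_(m + n) | Q *m Q^T = 1%:M}.
Let nu := usubmx (sval Q).
Let e := dsubmx (sval Q).

Lemma graph_coords (Z : 'M[R]_(n, m)) :
  (e + Z *m nu) *m e^T = 1%:M /\ (e + Z *m nu) *m nu^T = Z.
Proof.
have [nn ne en ee] := frame_gram Q; split.
  by rewrite mulmxDl [e *m _]ee -mulmxA [nu *m _]ne mulmx0 addr0.
by rewrite mulmxDl [e *m _]en add0r -mulmxA [nu *m _]nn mulmx1.
Qed.

Lemma oriented_span_refl (E : 'M[R]_(n, m + n)) : oriented_span E E.
Proof. by exists 1%:M; rewrite /= ?det1 ?ltr01 ?mul1mx. Qed.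

(** [chart_map] picks some preimage, so its value is identified by injectivity. Graph bases have
    identity block along [e], which forces [C = 1]. *)
Lemma grass_inv_inj : injective (grass_inv Q).
Proof.
move=> z w zw; have [ze zn] := graph_coords (vec_mx z).
have [we wn] := graph_coords (vec_mx w).
have [C _ CE] : grass_inv Q w (e + vec_mx z *m nu).
  by rewrite -zw; exact: oriented_span_refl.
have C1 : C = 1%:M by rewrite -ze -CE -mulmxA we mulmx1.
apply: (can_inj vec_mxK); rewrite -zn -CE C1 mul1mx; exact: wn.
Qed.

Lemma oriented_span_mulmx (C : 'M[R]_n) (E : 'M[R]_(n, m + n)) :
  0 < \det C -> oriented_span (C *m E) = oriented_span E.
Proof.
move=> C0; apply/seteqP; split=> _ [B /= B0 <-].
  by exists (B *m C); rewrite /= ?det_mulmx ?mulr_gt0 ?mulmxA.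
have Cu : C \in unitmx by rewrite unitmxE unitfE gt_eqF.
exists (B *m invmx C) => /=; first by rewrite det_mulmx det_inv mulr_gt0 ?invr_gt0.
by rewrite mulmxA mulmxKV.
Qed.

Lemma grass_inv_slope (J : 'M[R]_(n, m + n)) : 0 < \det (J *m e^T) ->
  grass_inv Q (mxvec (slope Q J)) = oriented_span J.
Proof.
move=> J0; have Ju : J *m e^T \in unitmx by rewrite unitmxE unitfE gt_eqF.
rewrite /grass_inv mxvecK {2}(slopeE Ju); exact/esym/oriented_span_mulmx.
Qed.

Lemma grass_chart_slope (J : 'M[R]_(n, m + n)) : 0 < \det (J *m e^T) ->
  @chart_map R (n * m) _ (grassmannian R n m) Q (oriented_span J) = mxvec (slope Q J).
Proof.
move=> J0; rewrite /= -(grass_inv_slope J0).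
by case: xgetP => [z _ /grass_inv_inj|/(_ (mxvec (slope Q J)))/(_ erefl)].
Qed.

Lemma grass_chart_det (J : 'M[R]_(n, m + n)) :
  range (grass_inv Q) (oriented_span J) -> 0 < \det (J *m e^T).
Proof.
move=> [z _ zJ]; have : grass_inv Q z J by rewrite zJ; exact: oriented_span_refl.
move=> [C /= C0 <-]; rewrite -mulmxA.
by have [-> _] := graph_coords (vec_mx z); rewrite mulmx1.
Qed.

(** Links the projection in [parallel_normal] to the product with the normal frame in
    [gauss_tension]; the converse direction holds because [frame_separate] applies to the projected
    vector. *)
Lemma normal_proj_eq0 (J : 'M[R]_(n, m + n)) (v : 'rV[R]_(m + n)) :
  row_free J -> J *m e^T \in unitmx ->
  normal_proj J v = 0 <-> v *m graph_normal Q (slope Q J) = 0.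
Proof.
move=> Jf Ju; have JV := mul_normal_slope Ju; split=> v0.
  by rewrite -(normal_proj_mul v JV) v0 mul0mx.
have [NJ _] := normal_projE v Jf.
apply: (@frame_separate _ _ _ Q _ _ (slope Q J)); last by rewrite normal_proj_mul.
have aT : (J *m e^T)^T \in unitmx by rewrite unitmx_tr.
apply: (can_inj (mulmxK aT)); rewrite mul0mx -mulmxA -trmx_mul -slopeE //.
Qed.

End GrassCharts.

(** The [e] part of the frame is an oriented orthonormalization of [J], so the chart is centred at
    the tangent space. *)
Lemma exists_adapted_frame (R : realType) n m (J : 'M[R]_(n, m + n)) : row_free J ->
  exists Q : {Q : 'M[R]_(m + n) | Q *m Q^T = 1%:M}, 0 < \det (J *m (dsubmx (sval Q))^T).
Proof.
move=> Jf; have [C C0 CE] := row_free_orthonormalize Jf.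
have [nu QQ] := orthonormal_extend CE.
exists (exist _ (col_mx nu (C *m J)) QQ); rewrite /= col_mxKd.
have : 0 < \det C * \det (J *m (C *m J)^T) by rewrite -det_mulmx mulmxA CE det1 ltr01.
by rewrite pmulr_rgt0.
Qed.

Section Main.
Variables (R : realType) (n m : nat) (M : topologicalType).
Variables (A : atlas R n M) (X : M -> 'rV[R]_(m + n)).
Hypotheses (hM : is_oriented_manifold A) (hX : is_smooth_immersion A X).

Lemma chart_rangeK (i : chart_idx A) x : chart_range i x ->
  chart_dom i (chart_inv i x) /\ chart_map i (chart_inv i x) = x.
Proof. by move=> [p ip <-]; rewrite (chart_invK hM). Qed.

Lemma gauss_map_chart (i : chart_idx A) x : chart_range i x ->
  gauss_map A X (chart_inv i x) = oriented_span (jacobian (X \o chart_inv i) x).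
Proof.
move=> /chart_rangeK[ip xE].
by rewrite (gauss_mapE hM hX ip) xE.
Qed.

Variable Q : {Q : 'M[R]_(m + n) | Q *m Q^T = 1%:M}.

Lemma gauss_tension (i : chart_idx A) x k : chart_range i x ->
  0 < \det (jacobian (X \o chart_inv i) x *m (dsubmx (sval Q))^T) ->
  row k (jacobian (X \o chart_inv i) x *m (dsubmx (sval Q))^T *m
    vec_mx (weighted_tension (induced_metric A X i) (grass_metric R n m Q)
      (gauss_weight X \o chart_inv i)
      (@chart_map R (n * m) _ (grassmannian R n m) Q \o gauss_map A X \o chart_inv i) x)) =
  'D_(delta_mx 0 k) (shrinker_section (X \o chart_inv i)) x *m
    graph_normal Q (slope Q (jacobian (X \o chart_inv i) x)).
Proof.
move=> ix x0; set F := X \o chart_inv i.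
have Uo : open (chart_range i) by exact: chart_range_open hM i.
have [Fs /(_ x ix) Jf] := hX i.
have xu : jacobian F x *m (dsubmx (sval Q))^T \in unitmx by rewrite unitmxE unitfE gt_eqF.
apply: (@tension_shrinker R n m Q F (chart_range i) Uo Fs _ x k ix Jf xu).
(* Positivity of this determinant is an open condition: near [x] the Gauss map stays in the chart,
   where its expression is the slope. *)
have dd : differentiable (fun y => \det (jacobian F y *m (dsubmx (sval Q))^T)) x.
  exact: differentiable_det (differentiable_frame_coord Uo Fs _ ix).
have d0 : \forall y \near x, 0 < \det (jacobian F y *m (dsubmx (sval Q))^T).
  by have /differentiable_continuous/cvgr_gt := dd; apply.
have xU : \forall y \near x, chart_range i y by exact: open_nbhs_nbhs.
apply: filterS2 xU d0 => y iy y0.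
by apply: etrans (congr1 _ (gauss_map_chart iy)) _; exact: grass_chart_slope.
Qed.

End Main.

Theorem theorem2p1 (R : realType) (n m : nat) (M : topologicalType)
    (A : atlas R n M) (X : M -> 'rV[R]_(m + n))
    (hM : is_oriented_manifold A) (hX : is_smooth_immersion A X) :
  weighted_harmonic (induced_metric A X) (grass_metric R n m)
    (gauss_weight X) (gauss_map A X)
  <->
  parallel_normal A X (fun i => shrinker_section (X \o chart_inv i)).
Proof.
split=> [harm i x ix v|par i Q p ip Qp].
  have [Fs /(_ x ix) Jf] := hX i.
  (* Harmonicity speaks of all charts; the one centred at the tangent space at this point
     suffices. *)
  have [Q Q0] := exists_adapted_frame Jf.
  set F := X \o chart_inv i in Fs Jf Q0 *; set J := jacobian F x in Jf Q0 *.
  have Ju : J *m (dsubmx (sval Q))^T \in unitmx by rewrite unitmxE unitfE gt_eqF.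
  apply/(normal_proj_eq0 _ Jf Ju).
  have [ip xE] := chart_rangeK hM ix.
  have Qp : @chart_dom R (n * m) _ (grassmannian R n m) Q (gauss_map A X (chart_inv i x)).
    rewrite (gauss_map_chart hM hX ix); exists (mxvec (slope Q J)) => //.
    exact: grass_inv_slope.
  have := harm i Q _ ip Qp; rewrite xE => t0.
  have Sd : differentiable (shrinker_section F) x.
    apply: (@differentiable_shrinker _ _ _ F (chart_range i) _ Fs x ix Jf).
    exact: chart_range_open hM i.
  (* By linearity in [v] only the coordinate directions, the rows of the Jacobian, need to be
     treated. *)
  rewrite deriveEjacobian // -mulmxA.
  suff -> : jacobian (shrinker_section F) x *m graph_normal Q (slope Q J) = 0 by rewrite mulmx0.
  apply/row_matrixP => k; rewrite row_mul row0 jacobian_row //.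
  apply: etrans (esym (gauss_tension hM hX k ix Q0)) _.
  by rewrite t0 linear0 mulmx0 row0.
have ix : chart_range i (chart_map i p) by exists p.
have [Fs /(_ _ ix) Jf] := hX i.
set x := chart_map i p in ix Jf *; set F := X \o chart_inv i in Fs Jf *.
set J := jacobian F x in Jf *.
(* Any chart that contains the tangent space makes this matrix invertible, so it can be cancelled
   from the tension. *)
have J0 : 0 < \det (J *m (dsubmx (sval Q))^T).
  by apply: grass_chart_det; rewrite -(gauss_mapE hM hX ip); exact: Qp.
have Ju : J *m (dsubmx (sval Q))^T \in unitmx by rewrite unitmxE unitfE gt_eqF.
apply: (can_inj vec_mxK); rewrite linear0; apply: (can_inj (mulKmx Ju)); rewrite mulmx0.
apply/row_matrixP => k; rewrite row0; apply: etrans (gauss_tension hM hX k ix J0) _.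
by apply/(normal_proj_eq0 _ Jf Ju); exact: par.
Qed.
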